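(* Let $V$ be a simple real Jordan algebra of dimension $n$ and rank $r$. The symbols $b^{(k)}_{\lambda,\mu}$ (where $\lambda,\mu\in\mathbb C$ and $k\ge 1$ is an integer) satisfy the recurrence relation $$\det\xi^{\lambda-\frac nr}\,\det\zeta^{\mu-\frac nr}\;b^{(k)}_{\lambda,\mu}(\xi,\zeta)=\det\left(\frac{\partial}{\partial\xi}-\frac{\partial}{\partial\zeta}\right)\left(\det\xi^{\lambda-\frac nr+1}\,\det\zeta^{\mu-\frac nr+1}\;b^{(k-1)}_{\lambda+1,\mu+1}(\xi,\zeta)\right).$$
   Context: $V$ is a simple real Jordan algebra with determinant polynomial $\det$ (of degree the rank $r$) and bilinear form $\tau(x,y)=\mathrm{tr}(xy)$. $V^*$ is the dual of $V$, with pairing $x.\xi$; for $\xi=\tau(\cdot,v)\in V^*$ put $\det\xi:=\det v$. For $\xi,\zeta\in V^*$, $\det(\frac{\partial}{\partial\xi}-\frac{\partial}{\partial\zeta})$ is the constant coefficient differential operator on $V^*\times V^*$ obtained by substituting $\frac{\partial}{\partial\xi}-\frac{\partial}{\partial\zeta}$ in the polynomial $\det$ on $V$, i.e. sending $e^{x.\xi+y.\zeta}$ to $\det(x-y)e^{x.\xi+y.\zeta}$; likewise $\det(\frac1i(\frac{\partial}{\partial\xi}-\frac{\partial}{\partial\zeta}))$ sends $e^{i(x.\xi+y.\zeta)}$ to $\det(x-y)e^{i(x.\xi+y.\zeta)}$. Convention on powers: for $s\in\mathbb C$ and a sign $\epsilon\in\{\pm\}$, $t^{s,\epsilon}$ denotes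 $|t|^s$ if $\epsilon=+$ and $\mathrm{sgn}(t)|t|^s$ if $\epsilon=-$ ($t\in\mathbb R^*$). In the recurrence relation the signs are omitted: the identity is considered on $\{\det\xi>0\}\times\{\det\zeta>0\}$ and then extended to $V^*\times V^*$. For generic $(s,\epsilon),(t,\eta)\in\mathbb C\times\{\pm\}$, $D_{s,t}$ is the differential operator with polynomial coefficients on $V^*\times V^*$ (it exists, and its coefficients are polynomial in $s,t$) such that $$\det\Big(\tfrac1i\big(\tfrac{\partial}{\partial\xi}-\tfrac{\partial}{\partial\zeta}\big)\Big)\circ(\det\xi^{s,\epsilon}\det\zeta^{t,\eta})=(\det\xi^{s-1,-\epsilon}\det\zeta^{t-1,-\eta})\circ D_{s,t},$$ where functions stand for multiplication operators. Its symbol $d_{s,t}$ is defined by $D_{s,t}(e^{i(x.\xi+y.\zeta)})=d_{s,t}(\xi,\zeta,x,y)e^{i(x.\xi+y.\zeta)}$. The source operator $F_{\lambda,\mu}$ is the differential operator with polynomial coefficients on $V\times V$ whose symbol $f_{\lambda,\mu}$, defined by $F_{\lambda,\mu}(e^{i(x.\xi+y.\zeta)})=f_{\lambda,\mu}(x,y,\xi,\zeta)e^{i(x.\xi+y.\zeta)}$, is normalized by $f_{\lambda,\mu}(x,y,\xi,\zeta)=d_{\lambda-\frac nr+1,\mu-\frac nr+1}(\xi,\zeta,x,y)$. Put $F^{(k)}_{\lambda,\mu}=F_{\lambda+k-1,\mu+k-1}\circ\dots\circ F_{\lambda,\mu}$ (with $F^{(0)}_{\lambda,\mu}=\mathrm{Id}$)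 and $B^{(k)}_{\lambda,\mu}=\mathrm{res}\circ F^{(k)}_{\lambda,\mu}$, where $\mathrm{res}(f)(x)=f(x,x)$. $B^{(k)}_{\lambda,\mu}$ has constant coefficients, and its symbol $b^{(k)}_{\lambda,\mu}(\xi,\zeta)$ is defined by $B^{(k)}_{\lambda,\mu}\big(e^{i(x.\xi+y.\zeta)}\big)(x)=b^{(k)}_{\lambda,\mu}(\xi,\zeta)e^{i(x.\xi+x.\zeta)}$; thus $b^{(0)}_{\lambda,\mu}=1$.
   Formalization: The right-hand side is multiplied by the constant i^{-r}, which the printed formula omits; with the stated normalizations the printed formula fails, e.g. for V = R, k = 1, where b^{(1)} = (1/i)(λζ − μξ). *)

(* Defs.v *)
From HB Require Import structures.
From mathcomp Require Import all_boot all_order all_algebra.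
From mathcomp Require Import complex.
From mathcomp Require Import boolp classical_sets reals topology normedtype.
From mathcomp Require Import sequences derive exp trigo.

Set Implicit Arguments.
Unset Strict Implicit.
Unset Printing Implicit Defensive.

Import Order.TTheory GRing.Theory Num.Theory.
Import numFieldNormedType.Exports.

Local Open Scope ring_scope.
Local Open Scope complex_scope.

Definition operator (R : realType) (W : Type) : Type :=
  (W -> R[i]) -> W -> R[i].

Definition cexp (R : realType) (z : R[i]) : R[i] :=
  (expR (complex.Re z))%:C *
  (cos (complex.Im z) +i* sin (complex.Im z)).

(* The power t^{s,eps} of a nonzero real t.  The sign eps is encoded as a
   boolean with false for + and true for -, so that -eps is ~~ eps.
   The value at t = 0 is meaningless. *)
Definition spow (R : realType) (eps : bool) (s : R[i]) (t : R) : R[i] :=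
  ((Num.sg t) ^+ eps)%:C * cexp (s * (ln `|t|)%:C).

Record simple_jordan (R : realType) (V : vectType R)
    (mul : V -> V -> V) (e : V) : Prop := SimpleJordan {
  sj_linear : forall x, linear (mul x);
  sj_comm : commutative mul;
  sj_unit : left_id e mul;
  sj_jordan : forall x y,
    mul x (mul (mul x x) y) = mul (mul x x) (mul x y);
  sj_neq0 : e != 0;
  sj_simple : forall I : {vspace V},
    (forall x y, y \in I -> mul x y \in I) -> I = 0%VS \/ I = fullv }.

Definition jpow (R : realType) (V : vectType R) (mul : V -> V -> V) (e : V)
  (x : V) (k : nat) : V := iter k (mul x) e.

Definition jeval (R : realType) (V : vectType R) (mul : V -> V -> V) (e : V)
  (p : {poly R}) (x : V) : V := \sum_(i < size p) p`_i *: jpow mul e x i.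

Definition is_minpoly (R : realType) (V : vectType R) (mul : V -> V -> V)
    (e x : V) (p : {poly R}) : Prop :=
  [/\ p \is monic, jeval mul e p x = 0 &
      forall q : {poly R}, q != 0 -> jeval mul e q x = 0 ->
        (size p <= size q)%N].

Inductive polyfun (R : realType) (W : vectType R) : (W -> R[i]) -> Prop :=
| polyfun_cst (c : R[i]) : polyfun (fun=> c)
| polyfun_lin (l : 'Hom(W, R^o)) : polyfun (fun w => (l w : R)%:C)
| polyfun_add p q : polyfun p -> polyfun q -> polyfun (fun w => p w + q w)
| polyfun_mul p q : polyfun p -> polyfun q -> polyfun (fun w => p w * q w).

(* [r] is the rank of V, i.e. the maximal degree of a minimal polynomial, and
   [m] is the generic minimal polynomial: its coefficients are polynomial
   functions on V and [m x] is the minimal polynomial of x for every regular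
   x.  By density of the regular elements, these properties determine [m]. *)
Definition generic_minpoly (R : realType) (V : vectType R)
    (mul : V -> V -> V) (e : V) (r : nat) (m : V -> {poly R}) : Prop :=
  [/\ forall x p, is_minpoly mul e x p -> (size p <= r.+1)%N,
      exists x p, is_minpoly mul e x p /\ size p = r.+1,
      forall x p, is_minpoly mul e x p -> size p = r.+1 -> m x = p &
      forall j : nat, polyfun (fun x => ((m x)`_j)%:C)].

(* m x = X^r - tr(x) X^(r-1) + ... + (-1)^r det(x) *)
Definition jtr (R : realType) (V : vectType R) (r : nat) (m : V -> {poly R})
  (x : V) : R := - (m x)`_(r.-1).

Definition jdet (R : realType) (V : vectType R) (r : nat) (m : V -> {poly R})
  (x : V) : R := (-1) ^+ r * (m x)`_0.

(* The linear map v |-> tau(., v) = tr(. v) from V to its dual. *)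
Definition tau_map (R : realType) (V : vectType R) (mul : V -> V -> V)
    (r : nat) (m : V -> {poly R}) : 'Hom(V, 'Hom(V, R^o)) :=
  linfun (fun v : V => linfun (fun x : V => jtr r m (mul x v) : R^o)).

(* tau is nondegenerate when V is simple, so that [tau_map] is bijective and
   the determinant of tau(., v) is det v. *)
Definition ddet (R : realType) (V : vectType R) (mul : V -> V -> V)
    (r : nat) (m : V -> {poly R}) (xi : 'Hom(V, R^o)) : R :=
  jdet r m ((tau_map mul r m)^-1%VF xi).

Definition pderiv (R : realType) (W : vectType R) (v : W) (g : W -> R[i])
    (w : W) : R[i] :=
  derive1 (fun h : R => complex.Re (g (w + h *: v)) : R^o) 0 +i*
  derive1 (fun h : R => complex.Im (g (w + h *: v)) : R^o) 0.

(* The topology of W is that of R^(dim W), through linear coordinates. *)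
Definition ccontinuous (R : realType) (W : vectType R) (g : W -> R[i])
    : Prop :=
  let lc : 'rV[R]_(\dim {:W}) -> W := passmx.vecof (vbasis {:W}) in
  continuous (fun u => complex.Re (g (lc u)) : R^o) /\
  continuous (fun u => complex.Im (g (lc u)) : R^o).

Definition pderivable (R : realType) (W : vectType R) (g : W -> R[i])
    (w v : W) : Prop :=
  derivable (fun h : R^o => complex.Re (g (w + h *: v)) : R^o) 0 1 /\
  derivable (fun h : R^o => complex.Im (g (w + h *: v)) : R^o) 0 1.

(* C^oo: all iterated directional derivatives exist and are continuous. *)
Definition smooth (R : realType) (W : vectType R) (g : W -> R[i]) : Prop :=
  forall vs : seq W,
    let dg := foldr (@pderiv R W) g vs in
    ccontinuous dg /\ forall w v, pderivable dg w v.

(* Differential operators with polynomial coefficients, as the algebra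
   generated by polynomial functions and directional derivatives. *)
Inductive poly_diffop (R : realType) (W : vectType R) :
    operator R W -> Prop :=
| poly_diffop_mul p : polyfun p -> poly_diffop (fun g w => p w * g w)
| poly_diffop_der v : poly_diffop (pderiv v)
| poly_diffop_add P Q : poly_diffop P -> poly_diffop Q ->
    poly_diffop (fun g w => P g w + Q g w)
| poly_diffop_comp P Q : poly_diffop P -> poly_diffop Q ->
    poly_diffop (fun g => P (Q g)).

Inductive cst_diffop (R : realType) (W : vectType R) :
    operator R W -> Prop :=
| cst_diffop_cst (c : R[i]) : cst_diffop (fun g w => c * g w)
| cst_diffop_der v : cst_diffop (pderiv v)
| cst_diffop_add P Q : cst_diffop P -> cst_diffop Q ->
    cst_diffop (fun g w => P g w + Q g w)
| cst_diffop_comp P Q : cst_diffop P -> cst_diffop Q ->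
    cst_diffop (fun g => P (Q g)).

(* Families of differential operators with polynomial coefficients, whose
   coefficients are moreover polynomial in the parameters (s, t). *)
Definition poly_diffop_family (R : realType) (W : vectType R)
    (D : R[i] -> R[i] -> operator R W) : Prop :=
  exists N : nat, exists E : 'I_N -> 'I_N -> operator R W,
    (forall a b, poly_diffop (E a b)) /\
    forall s t g w, D s t g w =
      \sum_(a < N) \sum_(b < N) s ^+ a * t ^+ b * E a b g w.

(* "For generic (s,t)": outside a proper algebraic subset of C^2. *)
Definition generic (R : realType) (G : R[i] -> R[i] -> Prop) : Prop :=
  exists q : {poly {poly R[i]}}, q != 0 /\
    forall s t : R[i], (q.[t%:P]).[s] != 0 -> G s t.

Definition pairing (R : realType) (V : vectType R)
    (x : V * V) (xi : 'Hom(V, R^o) * 'Hom(V, R^o)) : R :=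
  xi.1 x.1 + xi.2 x.2.

Definition cexpp (R : realType) (V : vectType R) (c : R[i])
    (x : V * V) (xi : 'Hom(V, R^o) * 'Hom(V, R^o)) : R[i] :=
  cexp (c * (pairing x xi)%:C).

(* [P] is the constant coefficient operator det(c^-1 (d/dxi - d/dzeta)) on
   V^* x V^*, i.e. P sends e^{c (x.xi + y.zeta)} to det(x-y) times itself. *)
Definition is_detop (R : realType) (V : vectType R) (r : nat)
    (m : V -> {poly R}) (c : R[i])
    (P : operator R ('Hom(V, R^o) * 'Hom(V, R^o))) : Prop :=
  cst_diffop P /\
  forall x xi, P (cexpp c x) xi = (jdet r m (x.1 - x.2))%:C * cexpp c x xi.

(* P o (det xi^{s,eps} det zeta^{t,eta})
     = (det xi^{s-1,-eps} det zeta^{t-1,-eta}) o D  where both sides make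
   sense, i.e. where det xi and det zeta are nonzero. *)
Definition intertwines (R : realType) (V : vectType R) (mul : V -> V -> V)
    (r : nat) (m : V -> {poly R}) (eps eta : bool) (s t : R[i])
    (P D : operator R ('Hom(V, R^o) * 'Hom(V, R^o))) : Prop :=
  forall phi : 'Hom(V, R^o) * 'Hom(V, R^o) -> R[i], smooth phi ->
  forall xi zeta, ddet mul r m xi != 0 -> ddet mul r m zeta != 0 ->
    P (fun u => spow eps s (ddet mul r m u.1) *
                spow eta t (ddet mul r m u.2) * phi u) (xi, zeta) =
    spow (~~ eps) (s - 1) (ddet mul r m xi) *
    spow (~~ eta) (t - 1) (ddet mul r m zeta) * D phi (xi, zeta).

(* [d] is the symbol of [D]: D(e^{i(x.xi+y.zeta)}) = d(xi,zeta,x,y) e^{...} *)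
Definition is_dual_symbol (R : realType) (V : vectType R)
    (D : operator R ('Hom(V, R^o) * 'Hom(V, R^o)))
    (d : 'Hom(V, R^o) * 'Hom(V, R^o) -> V * V -> R[i]) : Prop :=
  forall x xi, D (cexpp 'i%C x) xi = d xi x * cexpp 'i%C x xi.

(* [f] is the symbol of [F]: F(e^{i(x.xi+y.zeta)}) = f(x,y,xi,zeta) e^{...} *)
Definition is_symbol (R : realType) (V : vectType R)
    (F : operator R (V * V))
    (f : V * V -> 'Hom(V, R^o) * 'Hom(V, R^o) -> R[i]) : Prop :=
  forall x xi, F (fun y => cexpp 'i%C y xi) x = f x xi * cexpp 'i%C x xi.

Fixpoint Fiter (R : realType) (V : vectType R)
    (F : R[i] -> R[i] -> operator R (V * V))
    (k : nat) (la mu : R[i]) (g : V * V -> R[i]) : V * V -> R[i] :=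
  if k is j.+1 then F (la + j%:R) (mu + j%:R) (Fiter F j la mu g) else g.

Definition res (R : realType) (V : vectType R) (g : V * V -> R[i])
  (x : V) : R[i] := g (x, x).

Definition Bop (R : realType) (V : vectType R)
    (F : R[i] -> R[i] -> operator R (V * V))
    (k : nat) (la mu : R[i]) (g : V * V -> R[i]) : V -> R[i] :=
  res (Fiter F k la mu g).

(* [b] is the symbol of the constant coefficient bi-differential operator B. *)
Definition is_bisymbol (R : realType) (V : vectType R)
    (B : (V * V -> R[i]) -> V -> R[i])
    (b : 'Hom(V, R^o) * 'Hom(V, R^o) -> R[i]) : Prop :=
  forall xi x, B (fun y => cexpp 'i%C y xi) x = b xi * cexpp 'i%C (x, x) xi.

(* Main.v *)
From HB Require Import structures.
Require Import Defs.
From mathcomp Require Import all_boot all_order all_algebra.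
From mathcomp Require Import complex reals.
From mathcomp Require Import boolp classical_sets topology normedtype sequences.
From mathcomp Require Import derive realfun exp trigo ring.
Import GRing.Theory Num.Theory.
Import Order.TTheory numFieldNormedType.Exports.

(** Let E(x, xi) = e^(i x.xi) for x in the square of V and xi in the square of
    its dual, and put s = la - n/r + 1, t = mu - n/r + 1.  Since the source
    operator F_(la,mu), acting in x, has the same symbol as D_(s,t), acting in
    xi, both produce the same function from E.  Differential operators in x commute with
    differential operators in xi, hence

      F^(k)_(la,mu) E = F^(k-1)_(la+1,mu+1) D_(s,t) E
                      = D_(s,t) F^(k-1)_(la+1,mu+1) E,

    and at x = 0, where E = 1, this reads
    b^(k)_(la,mu) = D_(s,t) b^(k-1)_(la+1,mu+1)  (bisymbol_recurrence).
    Evaluated at x = 0 an iterate of F turns E into a polynomial in xi, so the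
    b^(k) are polynomials and D_(s,t) may be replaced by means of its
    intertwining relation.  Two points remain.

    The intertwining relation is known for generic (s, t) and for
    det((1/i)(d/dxi - d/dzeta)), whereas the recurrence is wanted for all
    (s, t) and for det(d/dxi - d/dzeta).  At a fixed point where the
    determinants do not vanish, applying a constant coefficient operator to
    det xi^s det zeta^t phi, with phi a polynomial, gives
    det xi^s det zeta^t times a polynomial in (s, t) (cst_diffop_powers), and
    D_(s,t) phi is polynomial in (s, t) as well.  Two polynomials in (s, t)
    that agree on an infinite grid, off the zeros of a nonzero polynomial, are
    equal (bipoly_grid).  The grid is made of the natural numbers s and t of
    the parities given by the signs: there the powers of the determinants are
    honest polynomials, so the two constant coefficient operators only have to
    be compared on polynomials.

    On polynomials the operators differ by the factor i^r (detop_polyfun).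
    A constant coefficient operator maps e^(c x.xi) to q(c) e^(c x.xi) with q
    a polynomial in c depending on x; for real c, q(c) = det(c(x.1 - x.2)),
    which is homogeneous of degree r in c (jdet_scale), so that
    q(i) = i^r det(x.1 - x.2).
    The operators thus agree on E up to i^r, and every polynomial in xi is
    obtained from E by an operator in x followed by the evaluation at x = 0
    (polyfun_exp_symbol), which again commutes with operators in xi.

    Homogeneity of the determinant is proved first for regular elements, where
    the generic minimal polynomial is the minimal polynomial, and then
    everywhere because a line through a regular element has only finitely many
    points that are not regular (regular_line). *)

Set Implicit Arguments.
Unset Strict Implicit.
Unset Printing Implicit Defensive.

Local Open Scope ring_scope.
Local Open Scope complex_scope.

(** * Derivatives of complex valued functions of a real variable *)

Section OneVariable.
Variable R : realType.
Implicit Types (g : R -> R[i]) (y : R -> R) (z : R[i]).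

(** Derivative at 0.  Restrictions of functions to lines through a point are
    all that directional derivatives see, so the base point 0 is enough. *)
Definition cdiff g z : Prop :=
  is_derive (0 : R^o) 1 (fun h : R^o => complex.Re (g h) : R^o) (complex.Re z)
  /\ is_derive (0 : R^o) 1 (fun h : R^o => complex.Im (g h) : R^o)
       (complex.Im z).

Lemma cdiff_near g g' z :
  (\forall h \near (0 : R), g h = g' h) -> cdiff g z -> cdiff g' z.
Proof.
move=> gg' [dre dim]; split.
- by apply: near_eq_is_derive dre; apply: filterS gg' => h ->.
- by apply: near_eq_is_derive dim; apply: filterS gg' => h ->.
Qed.

Lemma cdiff_cst z : cdiff (fun=> z) 0.
Proof. by split; exact: is_derive_cst. Qed.

Lemma cdiff_real y (y' : R) :
  is_derive (0 : R^o) 1 (y : R^o -> R^o) y' -> cdiff (fun h => (y h)%:C) y'%:C.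
Proof. by move=> dy; split => //=; exact: is_derive_cst. Qed.

Let ReD (z1 z2 : R[i]) :
  complex.Re (z1 + z2) = complex.Re z1 + complex.Re z2.
Proof. by case: z1 z2 => [? ?] []. Qed.

Let ImD (z1 z2 : R[i]) :
  complex.Im (z1 + z2) = complex.Im z1 + complex.Im z2.
Proof. by case: z1 z2 => [? ?] []. Qed.

Let ReM (z1 z2 : R[i]) : complex.Re (z1 * z2) =
  complex.Re z1 * complex.Re z2 - complex.Im z1 * complex.Im z2.
Proof. by case: z1 z2 => [? ?] []. Qed.

Let ImM (z1 z2 : R[i]) : complex.Im (z1 * z2) =
  complex.Re z1 * complex.Im z2 + complex.Im z1 * complex.Re z2.
Proof. by case: z1 z2 => [? ?] []. Qed.

Let deriveD (a b : R -> R) (a' b' : R) :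
  is_derive (0 : R^o) 1 (a : R^o -> R^o) a' ->
  is_derive (0 : R^o) 1 (b : R^o -> R^o) b' ->
  is_derive (0 : R^o) 1 (fun h : R^o => a h + b h : R^o) (a' + b').
Proof. exact: is_deriveD. Qed.

Let deriveN (a : R -> R) (a' : R) :
  is_derive (0 : R^o) 1 (a : R^o -> R^o) a' ->
  is_derive (0 : R^o) 1 (fun h : R^o => - a h : R^o) (- a').
Proof. exact: is_deriveN. Qed.

Let deriveM (a b : R -> R) (a' b' : R) :
  is_derive (0 : R^o) 1 (a : R^o -> R^o) a' ->
  is_derive (0 : R^o) 1 (b : R^o -> R^o) b' ->
  is_derive (0 : R^o) 1 (fun h : R^o => a h * b h : R^o) (a' * b 0 + a 0 * b').
Proof.
move=> da db; rewrite addrC [a' * _]mulrC.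
exact: (@is_deriveM R R^o a b 0 1 a' b').
Qed.

Lemma cdiffD g1 g2 z1 z2 :
  cdiff g1 z1 -> cdiff g2 z2 -> cdiff (fun h => g1 h + g2 h) (z1 + z2).
Proof.
move=> [r1 i1] [r2 i2]; split.
- rewrite ReD (_ : (fun _ => _) =
    fun h : R^o => complex.Re (g1 h) + complex.Re (g2 h) : R^o).
    exact: deriveD.
  by apply/funext => h; exact: ReD.
- rewrite ImD (_ : (fun _ => _) =
    fun h : R^o => complex.Im (g1 h) + complex.Im (g2 h) : R^o).
    exact: deriveD.
  by apply/funext => h; exact: ImD.
Qed.

Lemma cdiffM g1 g2 z1 z2 :
  cdiff g1 z1 -> cdiff g2 z2 ->
  cdiff (fun h => g1 h * g2 h) (z1 * g2 0 + g1 0 * z2).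
Proof.
move=> [r1 i1] [r2 i2]; split.
- rewrite (_ : (fun _ => _) = fun h : R^o => complex.Re (g1 h) *
      complex.Re (g2 h) + - (complex.Im (g1 h) * complex.Im (g2 h)) : R^o).
    2: by apply/funext => h; exact: ReM.
  apply: is_derive_eq (deriveD (deriveM r1 r2) (deriveN (deriveM i1 i2))) _.
  by rewrite ReD !ReM; ring.
- rewrite (_ : (fun _ => _) = fun h : R^o => complex.Re (g1 h) *
      complex.Im (g2 h) + complex.Im (g1 h) * complex.Re (g2 h) : R^o).
    2: by apply/funext => h; exact: ImM.
  apply: is_derive_eq (deriveD (deriveM r1 i2) (deriveM i1 r2)) _.
  by rewrite ImD !ImM; ring.
Qed.

Lemma cexpD z1 z2 : cexp (z1 + z2) = cexp z1 * cexp z2.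
Proof.
rewrite /cexp ReD ImD expRD cosD sinD; simpc.
by congr (_ +i* _); ring.
Qed.

Lemma cexp0 : cexp 0 = 1 :> R[i].
Proof. by rewrite /cexp /= expR0 cos0 sin0 mul1r. Qed.

Lemma cexp_neq0 z : cexp z != 0.
Proof.
apply/eqP => z0; have := cexp0; rewrite -(subrr z) cexpD z0 mul0r => /eqP.
by rewrite eq_sym oner_eq0.
Qed.

Lemma cdiff_cexp g z :
  cdiff g z -> cdiff (fun h => cexp (g h)) (z * cexp (g 0)).
Proof.
move=> [dr di]; rewrite /cexp.
set a : R -> R := fun h => complex.Re (g h).
set c : R -> R := fun h => complex.Im (g h).
have da : cdiff (fun h => (expR (a h))%:C)
    (expR (a 0) * complex.Re z)%:C.
  apply: cdiff_real; exact: (@is_derive1_comp R expR a 0 _ _ (is_derive_expR _) dr).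
have dc : cdiff (fun h => cos (c h) +i* sin (c h))
    ((- sin (c 0) * complex.Im z) +i* (cos (c 0) * complex.Im z)).
  split=> /=.
    exact: (@is_derive1_comp R cos c 0 _ _ (is_derive_cos _) di).
  exact: (@is_derive1_comp R sin c 0 _ _ (is_derive_sin _) di).
have := cdiffM da dc; congr cdiff.
rewrite -/(a 0) -/(c 0); case: z {dr di da dc} => x y; simpc.
by congr (_ +i* _) => /=; ring.
Qed.

Lemma cdiff_realE y z :
  cdiff (fun h => (y h)%:C) z ->
  exists2 y' : R, z = y'%:C & is_derive (0 : R^o) 1 (y : R^o -> R^o) y'.
Proof.
case: z => a b [/= dy [_ <-]]; exists a => //.
by congr (_ +i* _); exact: (derive_cst (0 : R^o) (0 : R^o)).
Qed.

Lemma cdiff_inv y z : y 0 != 0 -> cdiff (fun h => (y h)%:C) z ->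
  cdiff (fun h => ((y h)%:C)^-1) (- z * ((y 0)%:C)^-1 ^+ 2).
Proof.
move=> y0 /cdiff_realE[y' -> dy].
rewrite (_ : (fun _ => _) = fun h => ((y h)^-1)%:C); last first.
  by apply/funext => h; rewrite fmorphV.
rewrite (_ : _ * _ = ((- (y 0) ^- 2 *: y' : R))%:C); last first.
  by rewrite /GRing.scale /= rmorphM rmorphN fmorphV rmorphXn exprVn mulrC mulrN mulNr.
by apply: cdiff_real; exact: is_deriveV.
Qed.

Lemma cdiff_neq0_near y z : cdiff (fun h => (y h)%:C) z -> y 0 != 0 ->
  \forall h \near (0 : R), Num.sg (y h) = Num.sg (y 0) /\ y h != 0.
Proof.
move=> /cdiff_realE[y' _ dy] y0.
have cy : {for (0 : R), continuous y}.
  have [/derivable1_diffP dfy _] := dy.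
  exact: (@differentiable_continuous R R^o R^o _ _ dfy).
have [yp|yn|/esym/eqP] := ltgtP 0 (y 0); last by rewrite (negbTE y0).
- apply: filterS (cvgr_gt _ cy _ yp) => h /= hp.
  by rewrite !gtr0_sg ?gt_eqF.
- apply: filterS (cvgr_lt _ cy _ yn) => h /= hp.
  by rewrite !ltr0_sg ?lt_eqF.
Qed.

(** Near a point where y does not vanish its sign is constant, so that
    spow eps s y is locally the exponential of s ln(sg(y 0) y), up to a
    constant. *)
Lemma cdiff_spow (eps : bool) (s : R[i]) y z :
  y 0 != 0 -> cdiff (fun h => (y h)%:C) z ->
  cdiff (fun h => spow eps s (y h))
    (s * z * ((y 0)%:C)^-1 * spow eps s (y 0)).
Proof.
move=> y0 dz; have [y' zE dy] := cdiff_realE dz.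
set k := Num.sg (y 0).
have k2 : k * k = 1 by rewrite -expr2 sqr_sg y0.
have ky0 : 0 < k * y 0 by rewrite -normrEsg normr_gt0.
apply: (@cdiff_near (fun h => (k ^+ eps)%:C * cexp (s * (ln (k * y h))%:C))).
  apply: filterS (cdiff_neq0_near dz y0) => h [ksg _].
  by rewrite /spow [in RHS]normrEsg ksg.
have dk : is_derive (0 : R^o) 1 (fun h : R^o => k * y h : R^o) (k * y').
  by apply: (@is_deriveZ R R^o R^o (y : R^o -> R^o) k 0 1 y').
have dl : cdiff (fun h => (ln (k * y h))%:C) ((k * y 0)^-1 * (k * y'))%:C.
  apply: cdiff_real.
  apply: (@is_derive1_comp R (@ln R) (fun h => k * y h) 0 _ _ (is_derive1_ln ky0) dk).
have := cdiffM (cdiff_cst (k ^+ eps)%:C)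
  (cdiff_cexp (cdiffM (cdiff_cst s) dl)).
congr cdiff; rewrite !mul0r !add0r /spow normrEsg -/k zE.
have -> : (k * y 0)^-1 * (k * y') = y' / y 0.
  have k0 : k != 0 by apply: contraNneq y0 => k0; rewrite -sgr_eq0 -/k k0.
  by field; rewrite k0 y0.
by rewrite rmorphM fmorphV /=; ring.
Qed.

End OneVariable.

(** * Polynomial functions and constant coefficient operators *)

Section PolynomialFunctions.
Variables (R : realType) (W : vectType R).
Implicit Types (p q g : W -> R[i]) (v w : W).

Lemma pderiv_cdiff v g w z :
  cdiff (fun h => g (w + h *: v)) z -> pderiv v g w = z.
Proof.
case: z => a b [/= da db]; rewrite /pderiv !derive1E.
by congr (_ +i* _); exact: derive_val.
Qed.

Lemma pderivable_cdiff v g w z :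
  cdiff (fun h => g (w + h *: v)) z -> pderivable g w v.
Proof. by case=> -[? _] [? _]; split. Qed.

Lemma pderiv_near v g g' w :
  (\forall h \near (0 : R), g (w + h *: v) = g' (w + h *: v)) ->
  pderiv v g w = pderiv v g' w.
Proof.
move=> gg'; rewrite /pderiv !derive1E; congr (_ +i* _);
  by apply: near_eq_derive; apply: filterS gg' => h ->.
Qed.

Lemma pderiv_cst v z : pderiv v (fun=> z) = fun=> 0.
Proof.
by apply/funext => w; exact: (pderiv_cdiff (g := fun=> z) (cdiff_cst z)).
Qed.

Lemma cdiff_lin (l : 'Hom(W, R^o)) v w :
  cdiff (fun h => (l (w + h *: v) : R)%:C) (l v : R)%:C.
Proof.
apply: cdiff_real.
rewrite (_ : (fun _ => _) = fun h : R^o => (l w : R) + (l v : R) * h : R^o).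
  have := is_deriveD (is_derive_cst (l w : R^o) (0 : R^o) 1)
    (is_deriveZ (l v : R) (is_derive_id (0 : R^o) (1 : R^o))).
  by rewrite add0r /GRing.scale /= mulr1.
by apply/funext => h; rewrite linearD linearZ /= /GRing.scale /= mulrC.
Qed.

Lemma polyfun_cdiff p v : polyfun p ->
  exists2 p', polyfun p' & forall w, cdiff (fun h => p (w + h *: v)) (p' w).
Proof.
elim=> [c|l|p1 p2 P1 [q1 Q1 d1] P2 [q2 Q2 d2]|p1 p2 P1 [q1 Q1 d1] P2 [q2 Q2 d2]].
- by exists (fun=> 0) => [|w]; [exact: polyfun_cst|exact: cdiff_cst].
- exists (fun=> (l v : R)%:C) => [|w]; first exact: polyfun_cst.
  exact: cdiff_lin.
- exists (fun w => q1 w + q2 w) => [|w]; first exact: polyfun_add.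
  exact: cdiffD.
- exists (fun w => q1 w * p2 w + p1 w * q2 w) => [|w].
    by apply: polyfun_add; exact: polyfun_mul.
  by have := cdiffM (d1 w) (d2 w); rewrite scale0r addr0.
Qed.

Lemma polyfun_pderiv p v : polyfun p -> polyfun (pderiv v p).
Proof.
move=> /(polyfun_cdiff v)[p' Pp' dp].
by rewrite (_ : pderiv v p = p') //; apply/funext => w; exact: pderiv_cdiff.
Qed.

Lemma polyfun_comp (W' : vectType R) (f : 'Hom(W', W)) p :
  polyfun p -> polyfun (fun u => p (f u)).
Proof.
elim=> [c|l|p1 p2 _ h1 _ h2|p1 p2 _ h1 _ h2].
- exact: polyfun_cst.
- rewrite (_ : (fun _ => _) = fun u => ((l \o f)%VF u : R)%:C).
    exact: polyfun_lin.
  by apply/funext => w; rewrite lfunE.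
- exact: polyfun_add.
- exact: polyfun_mul.
Qed.

Lemma polyfun_exp p k : polyfun p -> polyfun (fun w => p w ^+ k).
Proof.
move=> Pp; elim: k => [|k IH]; first exact: polyfun_cst.
rewrite (_ : (fun _ => _) = fun w => p w * p w ^+ k); first exact: polyfun_mul.
by apply/funext => w; rewrite exprS.
Qed.

Lemma polyfun_ccontinuous p : polyfun p -> ccontinuous p.
Proof.
rewrite /ccontinuous; set lc := passmx.vecof _.
pose T := 'rV[R]_(\dim {:W}).
have cC (a : R) : continuous (fun _ : T => a : R^o) by exact: cst_continuous.
have cD (f g : T -> R^o) : continuous f -> continuous g ->
    continuous (fun u => f u + g u : R^o).
  by move=> cf cg u; exact: cvgD (cf u) (cg u).
have cN (f : T -> R^o) : continuous f -> continuous (fun u => - f u : R^o).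
  by move=> cf u; exact: cvgN (cf u).
have cM (f g : T -> R^o) : continuous f -> continuous g ->
    continuous (fun u => (f u : R) * g u : R^o).
  by move=> cf cg u; exact: cvgM (cf u) (cg u).
elim=> [c|l|p1 p2 _ [r1 i1] _ [r2 i2]|p1 p2 _ [r1 i1] _ [r2 i2]].
- by split; exact: cC.
- split; last exact: cC.
  rewrite (_ : (fun _ => _) = fun u : T =>
      \sum_j u ord0 j * (l (vbasis {:W})`_j : R) : R^o).
    apply: continuous_big => [|j _]; first exact: add_continuous.
    by apply: cM; [exact: coord_continuous|exact: cC].
  apply/funext => u; rewrite /lc /passmx.vecof linear_sum; apply: eq_bigr => j _.
  by rewrite linearZ.
- split.
  + rewrite (_ : (fun _ => _) = fun u : T =>
        complex.Re (p1 (lc u)) + complex.Re (p2 (lc u)) : R^o); first exact: cD.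
    by apply/funext => u; case: (p1 _) (p2 _) => [? ?] [].
  + rewrite (_ : (fun _ => _) = fun u : T =>
        complex.Im (p1 (lc u)) + complex.Im (p2 (lc u)) : R^o); first exact: cD.
    by apply/funext => u; case: (p1 _) (p2 _) => [? ?] [].
- split.
  + rewrite (_ : (fun _ => _) = fun u : T =>
        complex.Re (p1 (lc u)) * complex.Re (p2 (lc u)) -
        complex.Im (p1 (lc u)) * complex.Im (p2 (lc u)) : R^o).
      by apply: cD; [|apply: cN]; exact: cM.
    by apply/funext => u; case: (p1 _) (p2 _) => [? ?] [].
  + rewrite (_ : (fun _ => _) = fun u : T =>
        complex.Re (p1 (lc u)) * complex.Im (p2 (lc u)) +
        complex.Im (p1 (lc u)) * complex.Re (p2 (lc u)) : R^o).
      by apply: cD; exact: cM.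
    by apply/funext => u; case: (p1 _) (p2 _) => [? ?] [].
Qed.

Lemma polyfun_smooth p : polyfun p -> smooth p.
Proof.
move=> Pp vs /=.
have {Pp} : polyfun (foldr (@pderiv R W) p vs).
  by elim: vs => //= v vs; exact: polyfun_pderiv.
move: (foldr _ _ _) => q Pq; split; first exact: polyfun_ccontinuous.
by move=> w v; have [q' _ dq] := polyfun_cdiff v Pq; exact: pderivable_cdiff.
Qed.

(** Directional derivatives see only short segments through a point, so
    openness of U is expressed along lines. *)
Lemma cst_diffop_local P (U : W -> Prop) g g' :
  (forall w v, U w -> \forall h \near (0 : R), U (w + h *: v)) ->
  cst_diffop P -> (forall w, U w -> g w = g' w) ->
  forall w, U w -> P g w = P g' w.
Proof.
move=> Uo dP; elim: dP g g' => [c|v|P1 P2 _ h1 _ h2|P1 P2 _ h1 _ h2] g g' gg' w Uw.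
- by rewrite gg'.
- by apply: pderiv_near; apply: filterS (Uo w v Uw) => h; exact: gg'.
- by rewrite (h1 _ _ gg') // (h2 _ _ gg').
- by apply: h1 => // u Uu; exact: h2.
Qed.

Lemma cst_poly_diffop (P : operator R W) : cst_diffop P -> poly_diffop P.
Proof.
elim=> [c|v|P1 P2 _ h1 _ h2|P1 P2 _ h1 _ h2].
- by apply: poly_diffop_mul; exact: polyfun_cst.
- exact: poly_diffop_der.
- exact: poly_diffop_add.
- exact: poly_diffop_comp.
Qed.

End PolynomialFunctions.

(** * Operators in x commute with operators in xi on polynomials times exponentials *)

Definition bilin (R : realType) (W W' : vectType R) (B : W -> W' -> R) : Prop :=
  (forall y, exists l : 'Hom(W, R^o), forall x, B x y = l x) /\
  (forall x, exists l : 'Hom(W', R^o), forall y, B x y = l y).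

(** A class of smooth functions of two variables that contains
    e^(c B(x, y)) and is stable under differential operators with polynomial
    coefficients in either variable.  Being generated by sums and products, it
    allows to compare mixed derivatives on the generators alone. *)
Inductive exppoly (R : realType) (W W' : vectType R) (c : R[i])
    (B : W -> W' -> R) : (W -> W' -> R[i]) -> Prop :=
| exppoly_l p : polyfun p -> exppoly c B (fun x _ => p x)
| exppoly_r q : polyfun q -> exppoly c B (fun _ y => q y)
| exppoly_e : exppoly c B (fun x y => cexp (c * (B x y)%:C))
| exppoly_add G H : exppoly c B G -> exppoly c B H ->
    exppoly c B (fun x y => G x y + H x y)
| exppoly_mul G H : exppoly c B G -> exppoly c B H ->
    exppoly c B (fun x y => G x y * H x y).

Definition lft (R : realType) (W W' : Type) (L : operator R W)
  (G : W -> W' -> R[i]) : W -> W' -> R[i] := fun x y => L (fun x' => G x' y) x.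

Definition rgt (R : realType) (W W' : Type) (M : operator R W')
  (G : W -> W' -> R[i]) : W -> W' -> R[i] := fun x y => M (G x) y.

Lemma bilin_swap (R : realType) (W W' : vectType R) (B : W -> W' -> R) :
  bilin B -> bilin (fun y x => B x y).
Proof. by case. Qed.

(** The class is symmetric in its two variables: facts about operators in x
    transfer to operators in y by exchanging the roles of W and W'. *)
Lemma exppoly_swap (R : realType) (W W' : vectType R) (c : R[i])
    (B : W -> W' -> R) G :
  exppoly c B G -> exppoly c (fun y x => B x y) (fun y x => G x y).
Proof.
elim=> [p Pp|q Pq||G1 G2 _ h1 _ h2|G1 G2 _ h1 _ h2].
- exact: (@exppoly_r _ _ _ c (fun y x => B x y)).
- exact: (@exppoly_l _ _ _ c (fun y x => B x y)).
- exact: (@exppoly_e _ _ _ c (fun y x => B x y)).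
- exact: exppoly_add h1 h2.
- exact: exppoly_mul h1 h2.
Qed.

Section OneSide.
Variables (R : realType) (W W' : vectType R) (c : R[i]) (B : W -> W' -> R).
Hypothesis Bb : bilin B.
Implicit Types (G H : W -> W' -> R[i]) (L : operator R W).
Notation EP := (exppoly c B).

Lemma cdiff_bilin x v y : cdiff (fun h => (B (x + h *: v) y)%:C) (B v y)%:C.
Proof.
have [l lE] := Bb.1 y; rewrite lE.
rewrite (_ : (fun _ => _) = fun h => (l (x + h *: v) : R)%:C).
  exact: cdiff_lin.
by apply/funext => h; rewrite lE.
Qed.

Lemma cdiff_exp x v y :
  cdiff (fun h => cexp (c * (B (x + h *: v) y)%:C))
    (c * (B v y)%:C * cexp (c * (B x y)%:C)).
Proof.
have := cdiff_cexp (cdiffM (cdiff_cst c) (cdiff_bilin x v y)).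
by rewrite mul0r add0r scale0r addr0.
Qed.

Lemma lft_pderiv_exp v :
  lft (pderiv v) (fun x y => cexp (c * (B x y)%:C)) =
  fun x y => c * (B v y)%:C * cexp (c * (B x y)%:C).
Proof.
apply/funext => x; apply/funext => y.
exact: (pderiv_cdiff (g := fun x => cexp (c * (B x y)%:C)) (cdiff_exp x v y)).
Qed.

Lemma lft_pderiv_bilin v y0 (W0 : Type) :
  lft (pderiv v) (fun x (_ : W0) => c * (B x y0)%:C) = fun _ _ => c * (B v y0)%:C.
Proof.
apply/funext => x; apply/funext => y.
apply: (pderiv_cdiff (g := fun x => c * (B x y0)%:C)).
by have := cdiffM (cdiff_cst c) (cdiff_bilin x v y0); rewrite mul0r add0r.
Qed.

Lemma polyfun_bilinr v : polyfun (fun y => (B v y)%:C).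
Proof.
have [l lE] := Bb.2 v.
rewrite (_ : (fun _ => _) = fun y => (l y : R)%:C); first exact: polyfun_lin.
by apply/funext => y; rewrite lE.
Qed.

Lemma exppoly_cdiff v G : EP G ->
  exists2 G', EP G' & forall x y, cdiff (fun h => G (x + h *: v) y) (G' x y).
Proof.
elim=> [p Pp|q Pq||G1 G2 E1 [H1 F1 d1] E2 [H2 F2 d2]
       |G1 G2 E1 [H1 F1 d1] E2 [H2 F2 d2]].
- have [p' Pp' dp] := polyfun_cdiff v Pp.
  by exists (fun x _ => p' x) => // ; exact: exppoly_l.
- exists (fun _ _ => 0) => [|x y]; last exact: cdiff_cst.
  exact/exppoly_l/polyfun_cst.
- exists (fun x y => (c * (B v y)%:C) * cexp (c * (B x y)%:C)) => [|x y].
    apply: exppoly_mul; last exact: exppoly_e.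
    apply: (@exppoly_r _ _ _ c B (fun y => c * (B v y)%:C)).
    by apply: polyfun_mul; [exact: polyfun_cst|exact: polyfun_bilinr].
  exact: cdiff_exp.
- exists (fun x y => H1 x y + H2 x y) => [|x y]; first exact: exppoly_add.
  exact: cdiffD.
- exists (fun x y => H1 x y * G2 x y + G1 x y * H2 x y) => [|x y].
    by apply: exppoly_add; exact: exppoly_mul.
  by have := cdiffM (d1 x y) (d2 x y); rewrite scale0r addr0.
Qed.

Lemma exppoly_pderiv v G x y : EP G ->
  cdiff (fun h => G (x + h *: v) y) (lft (pderiv v) G x y).
Proof.
move=> /(exppoly_cdiff v)[G' _ dG].
by rewrite /lft (pderiv_cdiff (g := fun x' => G x' y) (dG x y)).
Qed.

Lemma lft_pderivD v G H : EP G -> EP H ->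
  lft (pderiv v) (fun x y => G x y + H x y) =
  fun x y => lft (pderiv v) G x y + lft (pderiv v) H x y.
Proof.
move=> EG EH; apply/funext => x; apply/funext => y.
apply: (pderiv_cdiff (g := fun x => G x y + H x y)).
exact: (cdiffD (exppoly_pderiv v x y EG) (exppoly_pderiv v x y EH)).
Qed.

Lemma lft_pderivM v G H : EP G -> EP H ->
  lft (pderiv v) (fun x y => G x y * H x y) =
  fun x y => lft (pderiv v) G x y * H x y + G x y * lft (pderiv v) H x y.
Proof.
move=> EG EH; apply/funext => x; apply/funext => y.
apply: (pderiv_cdiff (g := fun x => G x y * H x y)).
have := (cdiffM (exppoly_pderiv v x y EG) (exppoly_pderiv v x y EH)).
by rewrite scale0r addr0.
Qed.

Lemma exppoly_lft L G : poly_diffop L -> EP G -> EP (lft L G).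
Proof.
move=> dL; elim: dL G => [p Pp|v|L1 L2 _ h1 _ h2|L1 L2 _ h1 _ h2] G EG.
- by apply: exppoly_mul => //; exact: exppoly_l.
- have [G' EG' dG] := exppoly_cdiff v EG.
  rewrite (_ : lft _ G = G') //; apply/funext => x; apply/funext => y.
  exact: (pderiv_cdiff (g := fun x' => G x' y) (dG x y)).
- by apply: exppoly_add; [exact: h1|exact: h2].
- exact: (h1 (lft L2 G) (h2 G EG)).
Qed.

(** Additivity of directional derivatives needs differentiability, hence the
    restriction to the class; the factor a depends on y alone and is a
    constant for L. *)
Lemma lft_linear L (a : W' -> R[i]) G H : poly_diffop L -> EP G -> EP H ->
  lft L (fun x y => a y * G x y + H x y) =
  fun x y => a y * lft L G x y + lft L H x y.
Proof.
move=> dL; elim: dL G H => [p Pp|v|L1 L2 _ h1 _ h2|L1 L2 d1 h1 d2 h2] G H EG EH.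
- by apply/funext => x; apply/funext => y; rewrite /lft; ring.
- apply/funext => x; apply/funext => y.
  apply: (pderiv_cdiff (g := fun x => a y * G x y + H x y)).
  have := cdiffD (cdiffM (cdiff_cst (a y)) (exppoly_pderiv v x y EG))
    (exppoly_pderiv v x y EH).
  by rewrite mul0r add0r.
- have e1 := h1 G H EG EH; have e2 := h2 G H EG EH.
  apply/funext => x; apply/funext => y.
  move: (congr1 (fun f => f x y) e1) (congr1 (fun f => f x y) e2).
  by rewrite /lft => -> ->; ring.
- rewrite -[LHS]/(lft L1 (lft L2 _)) h2 // h1 //; exact: exppoly_lft.
Qed.

Lemma lft_mulr L (a : W' -> R[i]) G : poly_diffop L -> EP G ->
  lft L (fun x y => a y * G x y) = fun x y => a y * lft L G x y.
Proof.
move=> dL EG; pose Z : W -> W' -> R[i] := fun _ _ => 0.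
have EZ : EP Z by exact/exppoly_l/polyfun_cst.
have LZ : lft L Z = Z.
  have := lft_linear (fun=> - 1) dL EZ EZ.
  rewrite (_ : (fun x y => - 1 * Z x y + Z x y) = Z); last first.
    by apply/funext => x; apply/funext => y; rewrite /Z mulr0 addr0.
  by move=> ->; apply/funext => x; apply/funext => y; rewrite mulN1r addNr.
rewrite (_ : (fun x y => a y * G x y) = fun x y => a y * G x y + Z x y).
  by rewrite lft_linear // LZ; apply/funext => x; apply/funext => y; rewrite addr0.
by apply/funext => x; apply/funext => y; rewrite addr0.
Qed.

End OneSide.

Section Commutation.
Variables (R : realType) (W W' : vectType R) (c : R[i]) (B : W -> W' -> R).
Hypothesis Bb : bilin B.
Implicit Types (G H : W -> W' -> R[i]) (L : operator R W) (M : operator R W').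
Notation EP := (exppoly c B).
Let swp (T1 T2 : Type) (G : T1 -> T2 -> R[i]) := fun y x => G x y.

Lemma exppoly_rgt M G : poly_diffop M -> EP G -> EP (rgt M G).
Proof.
move=> dM EG.
exact: (exppoly_swap (exppoly_lft (bilin_swap Bb) dM (exppoly_swap EG))).
Qed.

Lemma rgt_linear M (a : W -> R[i]) G H : poly_diffop M -> EP G -> EP H ->
  rgt M (fun x y => a x * G x y + H x y) =
  fun x y => a x * rgt M G x y + rgt M H x y.
Proof.
move=> dM EG EH.
exact: (congr1 (fun K => swp K) (lft_linear (bilin_swap Bb) a dM
  (exppoly_swap EG) (exppoly_swap EH))).
Qed.

Lemma rgt_mulr M (a : W -> R[i]) G : poly_diffop M -> EP G ->
  rgt M (fun x y => a x * G x y) = fun x y => a x * rgt M G x y.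
Proof.
move=> dM EG.
exact: (congr1 (fun K => swp K) (lft_mulr (bilin_swap Bb) a dM
  (exppoly_swap EG))).
Qed.

Lemma rgt_pderivD w G H : EP G -> EP H ->
  rgt (pderiv w) (fun x y => G x y + H x y) =
  fun x y => rgt (pderiv w) G x y + rgt (pderiv w) H x y.
Proof.
move=> EG EH; exact: (congr1 (fun K => swp K) (lft_pderivD (bilin_swap Bb) w
  (exppoly_swap EG) (exppoly_swap EH))).
Qed.

Lemma rgt_pderivM w G H : EP G -> EP H ->
  rgt (pderiv w) (fun x y => G x y * H x y) =
  fun x y => rgt (pderiv w) G x y * H x y + G x y * rgt (pderiv w) H x y.
Proof.
move=> EG EH; exact: (congr1 (fun K => swp K) (lft_pderivM (bilin_swap Bb) w
  (exppoly_swap EG) (exppoly_swap EH))).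
Qed.

(** Both sides obey the same product rule, so the equality passes from the
    generators to the whole class; on the exponential both sides are
    (c B(v,w) + c^2 B(x,w) B(v,y)) e^(c B(x,y)). *)
Lemma pderiv_lft_rgt v w G : EP G ->
  lft (pderiv v) (rgt (pderiv w) G) = rgt (pderiv w) (lft (pderiv v) G).
Proof.
have dv := poly_diffop_der v; have dw := poly_diffop_der w.
elim=> [p Pp|q Pq||G1 G2 E1 h1 E2 h2|G1 G2 E1 h1 E2 h2].
- rewrite /lft /rgt; apply/funext => x; apply/funext => y.
  rewrite (_ : (fun x' => _) = fun=> 0) ?pderiv_cst //.
  by apply/funext => x'; rewrite pderiv_cst.
- rewrite /lft /rgt; apply/funext => x; apply/funext => y.
  rewrite (_ : (fun y' => pderiv v _ x) = fun=> 0) ?pderiv_cst //.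
  by apply/funext => y'; rewrite pderiv_cst.
- have EE := exppoly_e c B.
  have rE : rgt (pderiv w) (fun x y => cexp (c * (B x y)%:C)) =
      fun x y => c * (B x w)%:C * cexp (c * (B x y)%:C).
    exact: (congr1 (fun K => swp K) (lft_pderiv_exp c (bilin_swap Bb) w)).
  have El : EP (fun x _ => c * (B x w)%:C).
    apply: (@exppoly_l _ _ _ c B (fun x => c * (B x w)%:C)).
    apply: polyfun_mul; first exact: polyfun_cst.
    exact: (polyfun_bilinr (bilin_swap Bb)).
  have Er : EP (fun _ y => c * (B v y)%:C).
    apply: (@exppoly_r _ _ _ c B (fun y => c * (B v y)%:C)).
    by apply: polyfun_mul; [exact: polyfun_cst|exact: polyfun_bilinr].
  rewrite rE lft_pderiv_exp // (lft_pderivM Bb v El EE) (rgt_pderivM w Er EE).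
  rewrite rE lft_pderiv_exp // lft_pderiv_bilin //.
  have -> : rgt (pderiv w) (fun (_ : W) y => c * (B v y)%:C) =
      fun _ _ => c * (B v w)%:C.
    exact: (congr1 (fun K => swp K) (lft_pderiv_bilin c (bilin_swap Bb) w v W)).
  by apply/funext => x; apply/funext => y; ring.
- rewrite (rgt_pderivD w E1 E2) (lft_pderivD Bb v E1 E2).
  rewrite (lft_pderivD Bb v (exppoly_rgt dw E1) (exppoly_rgt dw E2)).
  rewrite (rgt_pderivD w (exppoly_lft Bb dv E1) (exppoly_lft Bb dv E2)).
  by rewrite h1 h2.
- rewrite (rgt_pderivM w E1 E2) (lft_pderivM Bb v E1 E2).
  have F1 := exppoly_rgt dw E1; have F2 := exppoly_rgt dw E2.
  have K1 := exppoly_lft Bb dv E1; have K2 := exppoly_lft Bb dv E2.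
  rewrite (lft_pderivD Bb v (exppoly_mul F1 E2) (exppoly_mul E1 F2)).
  rewrite (rgt_pderivD w (exppoly_mul K1 E2) (exppoly_mul E1 K2)).
  rewrite (lft_pderivM Bb v F1 E2) (lft_pderivM Bb v E1 F2).
  rewrite (rgt_pderivM w K1 E2) (rgt_pderivM w E1 K2) h1 h2.
  by apply/funext => x; apply/funext => y; exact: addrACA.
Qed.

Lemma pderiv_lft_rgt_diffop v M G : poly_diffop M -> EP G ->
  lft (pderiv v) (rgt M G) = rgt M (lft (pderiv v) G).
Proof.
have dv := poly_diffop_der v.
move=> dM; elim: dM G => [q Pq|w|M1 M2 d1 h1 d2 h2|M1 M2 d1 h1 d2 h2] G EG.
- apply/funext => x; apply/funext => y; rewrite /rgt.
  exact: (congr1 (fun K => K x y) (lft_mulr Bb q dv EG)).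
- exact: pderiv_lft_rgt.
- rewrite -[LHS]/(lft (pderiv v) (fun x y => rgt M1 G x y + rgt M2 G x y)).
  rewrite (lft_pderivD Bb v (exppoly_rgt d1 EG) (exppoly_rgt d2 EG)).
  by rewrite h1 // h2.
- rewrite -[LHS]/(lft (pderiv v) (rgt M1 (rgt M2 G))) h1 ?h2 //.
  exact: exppoly_rgt.
Qed.

Lemma lft_rgt L M G : poly_diffop L -> poly_diffop M -> EP G ->
  lft L (rgt M G) = rgt M (lft L G).
Proof.
move=> dL dM; elim: dL G => [p Pp|v|L1 L2 d1 h1 d2 h2|L1 L2 d1 h1 d2 h2] G EG.
- by rewrite -[RHS]/(rgt M (fun x y => p x * G x y)) rgt_mulr.
- exact: pderiv_lft_rgt_diffop.
- have EL1 := exppoly_lft Bb d1 EG; have EL2 := exppoly_lft Bb d2 EG.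
  have e1 := h1 _ EG; have e2 := h2 _ EG.
  rewrite -[LHS]/(fun x y => lft L1 (rgt M G) x y + lft L2 (rgt M G) x y) e1 e2.
  have := rgt_linear (fun=> 1) dM EL1 EL2.
  rewrite (_ : (fun x y => 1 * lft L1 G x y + lft L2 G x y) =
    lft (fun g w => L1 g w + L2 g w) G).
    by move=> ->; apply/funext => x; apply/funext => y; rewrite mul1r.
  by apply/funext => x; apply/funext => y; rewrite mul1r.
- rewrite -[LHS]/(lft L1 (lft L2 (rgt M G))) h2 // h1 //.
  exact: exppoly_lft.
Qed.

(** Where B(x, .) = 0 the exponential is 1 and only polynomials in y remain. *)
Lemma exppoly_polyfun_r x G : (forall y, B x y = 0) -> EP G -> polyfun (G x).
Proof.
move=> Bx0; elim=> [p Pp|q Pq||G1 G2 E1 h1 E2 h2|G1 G2 E1 h1 E2 h2] //.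
- exact: polyfun_cst.
- rewrite (_ : (fun y => _) = fun=> 1); first exact: polyfun_cst.
  by apply/funext => y; rewrite Bx0 mulr0 cexp0.
- exact: polyfun_add.
- exact: polyfun_mul.
Qed.

End Commutation.

(** * Polynomial dependence on the exponents *)

Section BivariatePolynomials.
Variable (R : realType).
Notation C := R[i].

Definition bipoly (h : C -> C -> C) : Prop :=
  exists q : {poly {poly C}}, forall s t, h s t = (q.[t%:P]).[s].

Lemma bipoly_cst c : bipoly (fun _ _ => c).
Proof. by exists c%:P%:P => s t; rewrite !hornerC. Qed.

Lemma bipoly_fst : bipoly (fun s _ => s).
Proof. by exists ('X)%:P => s t; rewrite hornerC hornerX. Qed.

Lemma bipoly_snd : bipoly (fun _ t => t).
Proof. by exists 'X => s t; rewrite hornerX hornerC. Qed.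

Lemma bipolyD h k : bipoly h -> bipoly k -> bipoly (fun s t => h s t + k s t).
Proof.
by move=> [p hp] [q kq]; exists (p + q) => s t; rewrite hp kq !hornerD.
Qed.

Lemma bipolyM h k : bipoly h -> bipoly k -> bipoly (fun s t => h s t * k s t).
Proof.
by move=> [p hp] [q kq]; exists (p * q) => s t; rewrite hp kq !hornerM.
Qed.

Lemma bipolyX h k : bipoly h -> bipoly (fun s t => h s t ^+ k).
Proof.
by move=> [p hp]; exists (p ^+ k) => s t; rewrite hp !horner_exp.
Qed.

Lemma bipoly_sum n (h : 'I_n -> C -> C -> C) : (forall i, bipoly (h i)) ->
  bipoly (fun s t => \sum_(i < n) h i s t).
Proof.
move=> H; have [q hq] := fin_all_exists H.
by exists (\sum_i q i) => s t; rewrite !horner_sum; apply: eq_bigr => i _; exact: hq.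
Qed.

Lemma poly_infinite_roots (A : idomainType) (a : nat -> A) (p : {poly A}) :
  injective a -> (forall j, p.[a j] = 0) -> p = 0.
Proof.
move=> ai pa; apply/eqP; apply: contraT => p0.
have := max_poly_roots p0 (rs := map a (iota 0 (size p))).
rewrite size_map size_iota ltnn map_inj_uniq // iota_uniq => -> //.
by apply/allP => _ /mapP[j _ ->]; apply/rootP.
Qed.

(** (h - k) q vanishes on the grid: where q does not vanish h = k, and
    elsewhere the factor q vanishes.  A nonzero q is then cancelled. *)
Lemma bipoly_grid (q : {poly {poly C}}) (a b : nat -> C) h k :
  injective a -> injective b -> q != 0 -> bipoly h -> bipoly k ->
  (forall j l, (q.[(b l)%:P]).[a j] != 0 -> h (a j) (b l) = k (a j) (b l)) ->
  forall s t, h s t = k s t.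
Proof.
move=> ai bi q0 [p hp] [p' kp] hk s t; rewrite hp kp.
suff /eqP : (p - p') * q = 0.
  by rewrite mulf_eq0 (negbTE q0) orbF subr_eq0 => /eqP ->.
apply: (@poly_infinite_roots _ (fun l => (b l)%:P)) => [l l' /polyC_inj/bi //|l].
apply: (@poly_infinite_roots _ a) => // j.
rewrite !hornerM hornerD hornerN hornerD hornerN.
have [->|/hk] := eqVneq (q.[(b l)%:P]).[a j] 0; first by rewrite mulr0.
by rewrite hp kp => ->; rewrite subrr mul0r.
Qed.

End BivariatePolynomials.

Section Powers.
Variables (R : realType) (W : vectType R) (d1 d2 : W -> R).
Hypothesis Pd1 : polyfun (fun w => (d1 w)%:C).
Hypothesis Pd2 : polyfun (fun w => (d2 w)%:C).
Variables eps eta : bool.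
Notation C := R[i].

(** Rational functions of w with denominators d1 and d2, polynomial in the
    exponents (s, t).  The logarithmic derivative of d1^s d2^t lies in this
    class, hence so does the cofactor of d1^s d2^t in all its derivatives. *)
Inductive ratfam : (C -> C -> W -> C) -> Prop :=
| ratfam_par h : bipoly h -> ratfam (fun s t _ => h s t)
| ratfam_poly p : polyfun p -> ratfam (fun _ _ => p)
| ratfam_inv1 : ratfam (fun _ _ w => (d1 w)%:C^-1)
| ratfam_inv2 : ratfam (fun _ _ w => (d2 w)%:C^-1)
| ratfam_add G H : ratfam G -> ratfam H ->
    ratfam (fun s t w => G s t w + H s t w)
| ratfam_mul G H : ratfam G -> ratfam H ->
    ratfam (fun s t w => G s t w * H s t w).

Definition nonvanishing (w : W) : Prop := d1 w != 0 /\ d2 w != 0.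

Definition powers (s t : C) (w : W) : C := spow eps s (d1 w) * spow eta t (d2 w).

Lemma nonvanishing_near w v : nonvanishing w ->
  \forall h \near (0 : R), nonvanishing (w + h *: v).
Proof.
move=> [w1 w2].
have [q1 _ c1] := polyfun_cdiff v Pd1; have [q2 _ c2] := polyfun_cdiff v Pd2.
have w0 (d : W -> R) : d w != 0 -> d (w + 0 *: v) != 0 by rewrite scale0r addr0.
apply: filterS2 (cdiff_neq0_near (c1 w) (w0 _ w1))
  (cdiff_neq0_near (c2 w) (w0 _ w2)) => h [_ ?] [_ ?]; by split.
Qed.

Lemma ratfam_bipoly G w : ratfam G -> bipoly (fun s t => G s t w).
Proof.
elim=> [h bh|p _|||G1 G2 _ h1 _ h2|G1 G2 _ h1 _ h2] //; try exact: bipoly_cst.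
- exact: bipolyD.
- exact: bipolyM.
Qed.

Lemma ratfam_cdiff v G : ratfam G -> exists2 G', ratfam G' &
  forall s t w, nonvanishing w -> cdiff (fun h => G s t (w + h *: v)) (G' s t w).
Proof.
have wE w : w + (0 : R) *: v = w by rewrite scale0r addr0.
have inv_case (d : W -> R) : polyfun (fun w => (d w)%:C) ->
    ratfam (fun _ _ w => (d w)%:C^-1) ->
    exists2 G', ratfam G' & forall (s t : C) w, d w != 0 ->
      cdiff (fun h => (d (w + h *: v))%:C^-1) (G' s t w).
  move=> Pd rd; have [q Pq dq] := polyfun_cdiff v Pd.
  exists (fun _ _ w => (- 1 * q w) * ((d w)%:C^-1 * (d w)%:C^-1)) => [|s t w dw].
    apply: ratfam_mul; last exact: ratfam_mul.
    apply: (ratfam_poly (p := fun w => - 1 * q w)).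
    by apply: polyfun_mul => //; exact: polyfun_cst.
  have := @cdiff_inv _ (fun h => d (w + h *: v)) _ _ (dq w).
  by rewrite wE expr2 mulN1r; apply.
elim=> [h bh|p Pp|||G1 G2 r1 [H1 R1 e1] r2 [H2 R2 e2]
       |G1 G2 r1 [H1 R1 e1] r2 [H2 R2 e2]].
- exists (fun _ _ _ => 0) => [|s t w _]; last exact: cdiff_cst.
  exact/(@ratfam_poly (fun=> 0))/polyfun_cst.
- have [q Pq dq] := polyfun_cdiff v Pp.
  by exists (fun _ _ => q) => //; exact: ratfam_poly.
- have [G' rG' dG'] := inv_case _ Pd1 ratfam_inv1.
  by exists G' => // s t w [w1 _]; exact: dG'.
- have [G' rG' dG'] := inv_case _ Pd2 ratfam_inv2.
  by exists G' => // s t w [_ w2]; exact: dG'.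
- exists (fun s t w => H1 s t w + H2 s t w) => [|s t w rw]; first exact: ratfam_add.
  by apply: cdiffD; [exact: e1|exact: e2].
- exists (fun s t w => H1 s t w * G2 s t w + G1 s t w * H2 s t w) => [|s t w rw].
    by apply: ratfam_add; exact: ratfam_mul.
  by have := cdiffM (e1 s t w rw) (e2 s t w rw); rewrite wE.
Qed.

Lemma cdiff_powers v : exists2 G, ratfam G & forall s t w, nonvanishing w ->
  cdiff (fun h => powers s t (w + h *: v)) (powers s t w * G s t w).
Proof.
have wE w : w + (0 : R) *: v = w by rewrite scale0r addr0.
have [q1 Pq1 c1] := polyfun_cdiff v Pd1; have [q2 Pq2 c2] := polyfun_cdiff v Pd2.
exists (fun s t w => s * q1 w * (d1 w)%:C^-1 + t * q2 w * (d2 w)%:C^-1).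
  apply: ratfam_add; apply: ratfam_mul; try apply: ratfam_mul.
  - exact/(ratfam_par (h := fun s _ => s))/bipoly_fst.
  - exact: (ratfam_poly Pq1).
  - exact: ratfam_inv1.
  - exact/(ratfam_par (h := fun _ t => t))/bipoly_snd.
  - exact: (ratfam_poly Pq2).
  - exact: ratfam_inv2.
move=> s t w [w1 w2].
have e1 := @cdiff_spow _ eps s (fun h => d1 (w + h *: v)) _ _ (c1 w).
have e2 := @cdiff_spow _ eta t (fun h => d2 (w + h *: v)) _ _ (c2 w).
rewrite !wE in e1 e2.
have := cdiffM (e1 w1) (e2 w2); congr cdiff; rewrite !wE /powers; ring.
Qed.

Lemma cst_diffop_powers P G : cst_diffop P -> ratfam G ->
  exists2 G', ratfam G' & forall s t w, nonvanishing w ->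
    P (fun w => powers s t w * G s t w) w = powers s t w * G' s t w.
Proof.
have wE w v : w + (0 : R) *: v = w by rewrite scale0r addr0.
move=> dP; elim: dP G => [c|v|P1 P2 d1' h1 d2' h2|P1 P2 d1' h1 d2' h2] G rG.
- exists (fun s t w => c * G s t w) => [|s t w _]; last by rewrite mulrCA.
  apply: ratfam_mul => //; exact/(ratfam_par (h := fun _ _ => c))/bipoly_cst.
- have [H rH dH] := ratfam_cdiff v rG; have [K rK dK] := cdiff_powers v.
  exists (fun s t w => K s t w * G s t w + H s t w) => [|s t w rw].
    by apply: ratfam_add => //; exact: ratfam_mul.
  apply: pderiv_cdiff.
  have := cdiffM (dK s t w rw) (dH s t w rw); congr cdiff; rewrite !wE; ring.
- have [H1 r1 e1] := h1 G rG; have [H2 r2 e2] := h2 G rG.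
  exists (fun s t w => H1 s t w + H2 s t w) => [|s t w rw]; first exact: ratfam_add.
  by rewrite e1 // e2 // mulrDr.
- have [H2 r2 e2] := h2 G rG; have [H1 r1 e1] := h1 H2 r2.
  exists H1 => // s t w rw; rewrite -e1 //.
  apply: (cst_diffop_local (U := nonvanishing)) => //; last exact: e2.
  by move=> u v; exact: nonvanishing_near.
Qed.

End Powers.

(** * Powers with signs *)

Section SpowFacts.
Variable R : realType.
Implicit Types (s : R[i]) (y : R).

Lemma spow_subr1 (eps : bool) s y : y != 0 ->
  spow (~~ eps) (s - 1) y = spow eps s y * y%:C^-1.
Proof.
move=> y0; have yn0 : `|y| != 0 by rewrite normr_eq0.
rewrite /spow mulrBl mul1r cexpD.
have -> : cexp (- (ln `|y|)%:C) = (`|y|^-1)%:C.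
  rewrite /cexp /= oppr0 cos0 sin0 mulr1 expRN lnK // posrE.
  by rewrite lt_neqAle eq_sym yn0 normr_ge0.
have -> : y%:C^-1 = (Num.sg y)%:C * (`|y|^-1)%:C.
  by rewrite -fmorphV -rmorphM normrEsg invfM mulVKf // sgr_eq0.
have k2 : (Num.sg y)%:C * (Num.sg y)%:C = 1 :> R[i].
  by rewrite -rmorphM -expr2 sqr_sg y0.
by case: eps; rewrite /= ?expr1 ?expr0 ?mul1r; [rewrite -[LHS]mul1r -{1}k2|]; ring.
Qed.

(** When the sign matches the parity of the exponent, the signed power is the
    ordinary power; the two may differ at y = 0, since ln 0 = 0. *)
Lemma spow_nat (j : nat) y : y != 0 -> spow (odd j) j%:R y = y%:C ^+ j.
Proof.
move=> y0; elim: j => [|j IH]; first by rewrite /spow !mul0r cexp0 mulr1.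
have yC0 : y%:C != 0 :> R[i] by rewrite fmorph_eq0.
have := spow_subr1 (odd j.+1) j.+1%:R y0.
rewrite -[j.+1%:R]natr1 addrK /= negbK IH natr1.
by move=> /(congr1 (fun z => z * y%:C)); rewrite mulfVK // exprSr => <-.
Qed.

End SpowFacts.

(** * Homogeneity of the determinant *)

Section DeterminantHomogeneity.
Variables (R : realType) (V : vectType R) (mul : V -> V -> V) (e : V).
Hypothesis mull : forall x, linear (mul x).
Hypothesis mulC : commutative mul.
Notation jpow := (jpow mul e).
Notation jeval := (jeval mul e).
Notation is_minpoly := (is_minpoly mul e).

Let mulr_sum x (I : finType) (c : I -> R) (v : I -> V) :
  mul x (\sum_i c i *: v i) = \sum_i c i *: mul x (v i).
Proof.
have m0 : mul x 0 = 0 by have := mull x (- 1) 0 0; rewrite !scaler0 addr0 scaleN1r addNr.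
by apply: (big_rec2 (fun a b => mul x a = b)) => // i a b _ <-; rewrite mull.
Qed.

Let mulZ x t y : mul x (t *: y) = t *: mul x y.
Proof.
have m0 : mul x 0 = 0 by have := mull x (- 1) 0 0; rewrite !scaler0 addr0 scaleN1r addNr.
by have := mull x t y 0; rewrite m0 !addr0.
Qed.

Lemma jpow_scale t x i : jpow (t *: x) i = t ^+ i *: jpow x i.
Proof.
elim: i => [|i IH]; first by rewrite expr0 scale1r.
rewrite /Defs.jpow !iterS -!/(Defs.jpow _ _ _ _) IH.
by rewrite mulZ mulC mulZ mulC scalerA exprSr.
Qed.

Lemma jeval_wide n (p : {poly R}) x : (size p <= n)%N ->
  jeval p x = \sum_(i < n) p`_i *: jpow x i.
Proof.
move=> pn; rewrite /Defs.jeval (big_ord_widen n (fun i => p`_i *: jpow x i)) //.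
rewrite [RHS](bigID (fun i : 'I_n => (i < size p)%N)) /= [X in _ + X]big1 ?addr0 //.
by move=> i; rewrite -leqNgt => ?; rewrite nth_default ?scale0r.
Qed.

(** If p annihilates x, then t^(deg p) p(X / t) annihilates t x; this is p',
    written without division. *)
Lemma is_minpoly_scale t x (p : {poly R}) : t != 0 -> is_minpoly x p ->
  exists p', [/\ is_minpoly (t *: x) p', size p' = size p &
    p'`_0 = t ^+ (size p).-1 * p`_0].
Proof.
move=> t0 [pm p0 pmin].
pose p' := \poly_(i < size p) (t ^+ ((size p).-1 - i) * p`_i).
have sp : (0 < size p)%N by rewrite size_poly_gt0 monic_neq0.
have lead : t ^+ ((size p).-1 - (size p).-1) * p`_(size p).-1 = 1.
  by rewrite subnn mul1r; move/monicP: pm.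
have sp' : size p' = size p by apply: size_poly_eq; rewrite lead oner_neq0.
exists p'; split=> //; last by rewrite coef_poly sp subn0.
split.
- by apply/monicP; rewrite lead_coefE sp' coef_poly prednK // leqnn lead.
- rewrite /Defs.jeval sp' (eq_bigr (fun i : 'I_(size p) =>
    t ^+ (size p).-1 *: (p`_i *: jpow x i))) => [|i _].
    by rewrite -scaler_sumr -/(Defs.jeval _ _ p x) p0 scaler0.
  rewrite coef_poly ltn_ord jpow_scale !scalerA mulrAC -exprD subnK //.
  by rewrite -ltnS prednK.
- move=> q q0 qx; rewrite sp'.
  pose q' := \poly_(i < size q) (t ^+ i * q`_i).
  have sq' : size q' = size q.
    apply: size_poly_eq; rewrite mulf_neq0 ?expf_neq0 //.
    by rewrite -lead_coefE lead_coef_eq0.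
  rewrite -sq'; apply: pmin; first by rewrite -size_poly_eq0 sq' size_poly_eq0.
  rewrite -qx /Defs.jeval sq'; apply: eq_bigr => i _.
  by rewrite coef_poly ltn_ord jpow_scale scalerA mulrC.
Qed.

Notation b := (vbasis {:V}).

Definition jpow_mx n x : 'M[R]_(n, \dim {:V}) :=
  \matrix_(i < n, j < \dim {:V}) coord b j (jpow x i).

Lemma mulmx_jpow n x (u : 'rV[R]_n) j :
  (u *m jpow_mx n x) ord0 j = coord b j (jeval (rVpoly u) x).
Proof.
rewrite (jeval_wide _ (size_poly _ _)) linear_sum mxE; apply: eq_bigr => i _.
by rewrite linearZ /= coef_rVpoly_ord mxE.
Qed.

Lemma jeval_rVpoly_eq0 n x (u : 'rV[R]_n) :
  u *m jpow_mx n x = 0 <-> jeval (rVpoly u) x = 0.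
Proof.
split=> [uA|ux]; last first.
  by apply/rowP => j; rewrite mulmx_jpow ux linear0 mxE.
rewrite (coord_vbasis (memvf (jeval _ x))) big1 // => j _.
by rewrite -mulmx_jpow uA mxE scale0r.
Qed.

Lemma rVpoly_neq0 n (u : 'rV[R]_n) : u != 0 -> rVpoly u != 0.
Proof. by apply: contra_neq => u0; rewrite -[u]rVpolyK u0 linear0. Qed.

(** The dim V + 1 powers x^0, ..., x^(dim V) are linearly dependent. *)
Lemma exists_minpoly x : exists p, is_minpoly x p.
Proof.
pose ann (k : nat) :=
  `[< exists2 q : {poly R}, q != 0 /\ jeval q x = 0 & size q = k >].
have exk : exists k, ann k.
  pose N := \dim {:V}.
  have : ~~ row_free (jpow_mx N.+1 x).
    by rewrite -row_leq_rank -ltnNge ltnS rank_leq_col.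
  rewrite -kermx_eq0 => /rowV0Pn[u /sub_kermxP uA u0].
  exists (size (rVpoly u)); apply/asboolP; exists (rVpoly u) => //.
  by split; [exact: rVpoly_neq0|exact/jeval_rVpoly_eq0].
have [k /asboolP[q [q0 qx] sq] kmin] := ex_minnP exk.
exists ((lead_coef q)^-1 *: q).
have l0 : (lead_coef q)^-1 != 0 by rewrite invr_eq0 lead_coef_eq0.
have sq' : size ((lead_coef q)^-1 *: q) = k by rewrite size_scale.
split.
- by apply/monicP; rewrite lead_coefZ mulVf // lead_coef_eq0.
- rewrite /Defs.jeval sq' -sq (eq_bigr (fun i : 'I_(size q) =>
    (lead_coef q)^-1 *: (q`_i *: jpow x i))) => [|i _].
    by rewrite -scaler_sumr -/(Defs.jeval _ _ q x) qx scaler0.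
  by rewrite coefZ scalerA.
- by move=> p p0 px; rewrite sq'; apply: kmin; apply/asboolP; exists p.
Qed.

Lemma jpow_line x d i j : exists P : {poly R}, forall h,
  coord (vbasis {:V}) j (jpow (x + h *: d) i) = P.[h].
Proof.
elim: i j => [|i IH] j.
  by exists (coord (vbasis {:V}) j e)%:P => h; rewrite hornerC.
have [Q hQ] := fin_all_exists IH.
pose b := vbasis {:V}; pose c := coord b j.
exists (\sum_k Q k * ((c (mul x b`_k))%:P + (c (mul d b`_k))%:P * 'X)) => h.
rewrite /Defs.jpow iterS -/(Defs.jpow _ _ _ _).
rewrite (coord_vbasis (memvf (jpow _ i))) mulr_sum linear_sum /= horner_sum.
apply: eq_bigr => k _; rewrite linearZ /= hQ hornerM; congr (_ * _).
rewrite hornerD hornerC hornerMX hornerC mulC addrC mull linearP /=.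
by rewrite -/b -/c ![mul b`_k _]mulC addrC mulrC.
Qed.

Variables (r : nat) (m : V -> {poly R}).
Hypothesis hm : generic_minpoly mul e r m.

(** The powers x0^0, ..., x0^(r-1) are independent, so their coordinate matrix
    has a right inverse B.  With the powers of x0 + h x in place of those of
    x0, the determinant of the product with B is a polynomial g in h, equal to
    1 at h = 0; where it does not vanish the first r powers are independent,
    and the minimal polynomial has the maximal degree r. *)
Lemma regular_line x0 x p : is_minpoly x0 p -> size p = r.+1 ->
  exists2 g : {poly R}, g != 0 & forall h, g.[h] != 0 ->
    exists2 q, is_minpoly (x0 + h *: x) q & size q = r.+1.
Proof.
have [rmax _ _ _] := hm.
move=> [pm px pmin] sp; pose A h := jpow_mx r (x0 + h *: x).
have [P hP] := fin_all_exists (fun i : 'I_r => fin_all_exists (jpow_line x0 x i)).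
have /row_freeP[B AB] : row_free (A 0).
  rewrite -kermx_eq0; apply/rowV0P => u /sub_kermxP.
  rewrite /A scale0r addr0 => /jeval_rVpoly_eq0 ux; apply/eqP.
  apply: contraT => /rVpoly_neq0/pmin/(_ ux).
  by rewrite sp ltnNge size_poly.
pose M := \matrix_(i, k) \sum_j P i j * (B j k)%:P.
have ME h : (\det M).[h] = \det (A h *m B).
  rewrite -[LHS]/(horner_eval h (\det M)) -det_map_mx; congr (\det _).
  apply/matrixP => i k; rewrite !mxE rmorph_sum.
  by apply: eq_bigr => j _; rewrite rmorphM /= /horner_eval hornerC -hP mxE.
exists (\det M) => [|h].
  by apply: contra_eq_neq (ME 0) => ->; rewrite horner0 AB det1 eq_sym oner_neq0.
rewrite ME => dh; have [q qm] := exists_minpoly (x0 + h *: x).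
exists q => //; apply/eqP; rewrite eqn_leq (rmax _ _ qm) ltnNge /=.
have [qmon qx _] := qm; apply: contraL (monic_neq0 qmon) => sq.
rewrite negbK -(poly_rV_K sq).
have /jeval_rVpoly_eq0/(congr1 (mulmx^~ B)) :
  jeval (rVpoly (poly_rV q : 'rV_r)) (x0 + h *: x) = 0 by rewrite poly_rV_K.
have uAB : A h *m B \in unitmx by rewrite unitmxE unitfE.
rewrite mul0mx -mulmxA => /(congr1 (mulmx^~ (invmx (A h *m B)))).
by rewrite mulmxK // mul0mx => ->; rewrite linear0.
Qed.

Lemma polyfun_line (W : vectType R) (p : W -> R[i]) w v : polyfun p ->
  exists P : {poly R[i]}, forall h : R, p (w + h *: v) = P.[h%:C].
Proof.
elim=> [c|l|p1 p2 _ [q1 e1] _ [q2 e2]|p1 p2 _ [q1 e1] _ [q2 e2]].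
- by exists c%:P => h; rewrite hornerC.
- exists ((l w : R)%:C%:P + (l v : R)%:C%:P * 'X) => h.
  rewrite hornerD hornerC hornerMX hornerC -rmorphM -rmorphD linearD linearZ.
  by rewrite /GRing.scale /= mulrC.
- by exists (q1 + q2) => h; rewrite hornerD e1 e2.
- by exists (q1 * q2) => h; rewrite hornerM e1 e2.
Qed.

Lemma polyfun_jdet : polyfun (fun x => (jdet r m x)%:C).
Proof.
have [_ _ _ Pm] := hm.
rewrite (_ : (fun _ => _) = fun x => ((-1) ^+ r : R)%:C * ((m x)`_0)%:C).
  by apply: polyfun_mul; [exact: polyfun_cst|exact: Pm].
by apply/funext => x; rewrite -rmorphM.
Qed.

(** On the line from a regular point x0 to x, the difference of the two sides
    is a polynomial in h that vanishes at all regular points, hence it is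
    zero; x is the point h = 1. *)
Lemma jdet_scale t x : t != 0 -> jdet r m (t *: x) = t ^+ r * jdet r m x.
Proof.
move=> t0; have [rmax [x0 [p0 [p0m sp0]]] mE Pm] := hm.
have [g g0 hg] := regular_line (x - x0) p0m sp0.
have [P eP] := polyfun_line x0 (x - x0) polyfun_jdet.
have [Q eQ] := polyfun_line (t *: x0) (t *: (x - x0)) polyfun_jdet.
pose T := Q - (t ^+ r)%:C *: P.
have TE h : T.[h%:C] =
  (jdet r m (t *: (x0 + h *: (x - x0))) - t ^+ r * jdet r m (x0 + h *: (x - x0)))%:C.
  rewrite /T hornerD hornerN hornerZ -eP -eQ -rmorphM -rmorphB.
  suff -> : t *: (x0 + h *: (x - x0)) = t *: x0 + h *: (t *: (x - x0)) by [].
  by rewrite [LHS]scalerDr [in LHS]scalerA [t * h]mulrC -scalerA.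
have : T * map_poly (fun z : R => z%:C) g = 0.
  apply: (@poly_infinite_roots _ (fun j => (j%:R : R)%:C)) => [j l|j].
    by move=> /complexI/eqP; rewrite eqr_nat => /eqP.
  rewrite hornerM TE horner_map /=.
  have [->|/hg[q qm sq]] := eqVneq g.[j%:R] 0; first by rewrite mulr0.
  have [q' [q'm sq' q'0]] := is_minpoly_scale t0 qm.
  rewrite /jdet (mE _ _ qm sq) (mE _ _ q'm) ?sq' // q'0 sq /=.
  by rewrite mulrCA subrr mul0r.
move/eqP; rewrite mulf_eq0 map_poly_eq0 (negbTE g0) orbF => /eqP T0.
have xE : x0 + 1 *: (x - x0) = x by rewrite scale1r addrC subrK.
have := TE 1; rewrite T0 horner0 xE.
by move/esym/complexI/eqP; rewrite subr_eq0 => /eqP.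
Qed.

End DeterminantHomogeneity.

(** * Exponentials as test functions *)

Lemma linear_lfun (R : realType) (W W' : vectType R) (f : W -> W') :
  linear f -> exists g : 'Hom(W, W'), forall w, f w = g w.
Proof.
move=> lf; pose L := GRing.isLinear.Build _ _ _ _ f lf.
pose f' : {linear W -> W'} := HB.pack f L.
by exists (linfun f') => w; rewrite lfunE.
Qed.

Section Duality.
Variables (R : realType) (V : vectType R).

(** V is finite dimensional, hence reflexive. *)
Lemma lfun_reflexive (l : 'Hom('Hom(V, R^o), R^o)) :
  exists v : V, forall xi : 'Hom(V, R^o), xi v = l xi.
Proof.
pose b := vbasis {:V}; pose f i : 'Hom(V, R^o) := linfun (coord b i).
exists (\sum_i (l (f i) : R) *: b`_i) => xi.
have xiE : xi = \sum_(i < \dim {:V}) (xi b`_i : R) *: f i.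
  apply/lfunP => x; rewrite sum_lfunE {1}(coord_vbasis (memvf x)) linear_sum.
  apply: eq_bigr => i _; rewrite linearZ scale_lfunE lfunE /=.
  by rewrite /GRing.scale /= mulrC.
rewrite [in RHS]xiE !linear_sum; apply: eq_bigr => i _.
rewrite !linearZ; exact: mulrC.
Qed.

Lemma bilin_pairing : bilin (@pairing R V).
Proof.
split=> [xi|x]; apply: linear_lfun => a u v; rewrite /pairing /=.
  by rewrite !linearP /= scalerDr addrACA.
by rewrite !add_lfunE !scale_lfunE /= scalerDr addrACA.
Qed.

(** Every linear form in xi is a derivative of the exponential in some
    direction x: this is what makes exponentials sufficient to test operators
    on all polynomials in polyfun_exp_symbol. *)
Lemma pairing_surj (l : 'Hom(('Hom(V, R^o) * 'Hom(V, R^o))%type, R^o)) :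
  exists v, forall xi, pairing v xi = l xi.
Proof.
have [l1 l1E] : exists g : 'Hom('Hom(V, R^o), R^o), forall xi, l (xi, 0) = g xi.
  apply: linear_lfun => a u v; rewrite -linearP; congr (l _).
  by congr pair; rewrite /= scaler0 addr0.
have [l2 l2E] : exists g : 'Hom('Hom(V, R^o), R^o), forall xi, l (0, xi) = g xi.
  apply: linear_lfun => a u v; rewrite -linearP; congr (l _).
  by congr pair; rewrite /= scaler0 addr0.
have [v1 v1E] := lfun_reflexive l1; have [v2 v2E] := lfun_reflexive l2.
exists (v1, v2) => -[xi zeta]; rewrite /pairing /= v1E v2E -l1E -l2E -linearD.
by congr (l _); congr pair; rewrite /= ?addr0 ?add0r.
Qed.

End Duality.

Section ExponentialTest.
Variables (R : realType) (W W' : vectType R) (c : R[i]) (B : W -> W' -> R).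
Hypothesis Bb : bilin B.
Hypothesis Bsurj : forall l : 'Hom(W', R^o), exists v, forall y, B v y = l y.
Hypothesis c0 : c != 0.
Notation E := (fun x y => cexp (c * (B x y)%:C)).

(** Quantization: a linear form B(v, .) is the symbol of c^-1 d/dv, and
    products of symbols come from compositions of operators. *)
Lemma polyfun_exp_symbol p : polyfun p ->
  exists2 M : operator R W, poly_diffop M & lft M E = fun x y => p y * E x y.
Proof.
elim=> [k|l|p1 p2 _ [M1 d1 e1] _ [M2 d2 e2]|p1 p2 _ [M1 d1 e1] _ [M2 d2 e2]].
- exists (fun g w => k * g w) => //.
  exact/(poly_diffop_mul (p := fun=> k))/polyfun_cst.
- have [v vE] := Bsurj l.
  exists (fun g w => c^-1 * pderiv v g w).
    apply: (poly_diffop_comp (P := fun g w => c^-1 * g w)).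
      exact/(poly_diffop_mul (p := fun=> c^-1))/polyfun_cst.
    exact: poly_diffop_der.
  apply/funext => x; apply/funext => y; rewrite -vE.
  have := congr1 (fun K => K x y) (lft_pderiv_exp c Bb v).
  by rewrite /lft => ->; rewrite !mulrA mulVf // mul1r.
- exists (fun g w => M1 g w + M2 g w); first exact: poly_diffop_add.
  apply/funext => x; apply/funext => y; rewrite mulrDl.
  by congr (_ + _); [exact: (congr1 (fun K => K x y) e1)
                    |exact: (congr1 (fun K => K x y) e2)].
- exists (fun g => M1 (M2 g)); first exact: poly_diffop_comp.
  rewrite -[LHS]/(lft M1 (lft M2 E)) e2.
  rewrite (lft_mulr Bb p2 d1 (exppoly_e c B)) e1.
  by apply/funext => x; apply/funext => y; rewrite mulrCA mulrA.
Qed.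

(** A polynomial p is M E at x = 0 for some operator M in x.  Since M commutes
    with M1 and M2, their values on p are determined by those on E. *)
Lemma diffop_eq_polyfun (M1 M2 : operator R W') p :
  poly_diffop M1 -> poly_diffop M2 -> rgt M1 E = rgt M2 E ->
  polyfun p -> M1 p = M2 p.
Proof.
move=> d1 d2 e12 /polyfun_exp_symbol[M dM ME].
have -> : p = lft M E 0.
  rewrite ME; apply/funext => y; have [l lE] := Bb.1 y.
  by rewrite lE linear0 mulr0 cexp0 mulr1.
have EE := exppoly_e c B.
rewrite -[LHS]/(rgt M1 (lft M E) 0) -[RHS]/(rgt M2 (lft M E) 0).
by rewrite -(lft_rgt Bb dM d1 EE) -(lft_rgt Bb dM d2 EE) e12.
Qed.

End ExponentialTest.

(** The symbol on the complex line spanned by a linear form, as a polynomial q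
    in the complex parameter c; it allows to pass from real c to c = i. *)
Lemma cst_diffop_exp (R : realType) (W : vectType R) (P : operator R W)
    (l : 'Hom(W, R^o)) : cst_diffop P ->
  exists q : {poly R[i]}, forall k c w,
    P (fun w => k * cexp (c * (l w : R)%:C)) w =
    k * q.[c] * cexp (c * (l w : R)%:C).
Proof.
elim=> [a|v|P1 P2 _ [q1 e1] _ [q2 e2]|P1 P2 _ [q1 e1] _ [q2 e2]].
- by exists a%:P => k c w; rewrite hornerC mulrA [a * k]mulrC.
- exists ((l v : R)%:C *: 'X) => k c w; apply: pderiv_cdiff.
  have := cdiffM (cdiff_cst k) (cdiff_cexp (cdiffM (cdiff_cst c) (cdiff_lin l v w))).
  congr cdiff; rewrite scale0r addr0 hornerZ hornerX; ring.
- by exists (q1 + q2) => k c w; rewrite e1 e2 hornerD; ring.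
- exists (q1 * q2) => k c w; rewrite hornerM.
  rewrite (_ : P2 _ = fun w => k * q2.[c] * cexp (c * (l w : R)%:C)).
    by rewrite e1; ring.
  by apply/funext => u; exact: e2.
Qed.

(** * Comparison of the two determinant operators *)

Section DeterminantOperators.
Variables (R : realType) (V : vectType R) (r : nat) (m : V -> {poly R}).
Hypothesis homog : forall t x, t != 0 -> jdet r m (t *: x) = t ^+ r * jdet r m x.
Variables P Pi : operator R ('Hom(V, R^o) * 'Hom(V, R^o)).
Hypothesis hP : is_detop r m 1 P.
Hypothesis hPi : is_detop r m 'i%C Pi.

(** For real c the function e^(c x.xi) is the exponential at the point c x, so
    q(c) = det(c(x.1 - x.2)) = c^r det(x.1 - x.2) for infinitely many c, and
    this identity of polynomials is read at c = i. *)
Lemma detop_exp x xi : P (cexpp 'i%C x) xi = 'i%C ^+ r * Pi (cexpp 'i%C x) xi.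
Proof.
rewrite hPi.2; have [l lE] := (bilin_pairing V).2 x.
have [q qE] := cst_diffop_exp l hP.1.
have {}qE c y : P (cexpp c x) y = q.[c] * cexpp c x y.
  rewrite /cexpp lE -[q.[c]]mul1r -qE; congr (P _ y).
  by apply/funext => u; rewrite mul1r lE.
have scaleE t : cexpp 1 (t *: x) = cexpp t%:C x.
  by apply/funext => y; rewrite /cexpp mul1r -rmorphM /pairing !linearZ -mulrDr.
rewrite qE; suff -> : q = (jdet r m (x.1 - x.2))%:C *: 'X^r.
  by rewrite hornerZ hornerXn; ring.
apply/eqP; rewrite -subr_eq0; apply/eqP.
apply: (@poly_infinite_roots _ (fun j => j.+1%:R)) => [j k /eqP|j].
  by rewrite eqr_nat => /eqP[].
have jE : j.+1%:R = (j.+1%:R : R)%:C by rewrite rmorph_nat.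
rewrite hornerD hornerN hornerZ hornerXn; apply/eqP; rewrite subr_eq0; apply/eqP.
apply: (mulIf (cexp_neq0 (j.+1%:R * (pairing x 0)%:C))).
rewrite -[LHS]qE jE -scaleE hP.2 /= -scalerBr homog ?pnatr_eq0 //.
by rewrite scaleE rmorphM rmorphXn; congr (_ * _); rewrite mulrC.
Qed.

Lemma detop_polyfun p xi : polyfun p -> P p xi = 'i%C ^+ r * Pi p xi.
Proof.
move=> Pp; have [cP _] := hP; have [cPi _] := hPi.
have i0 : 'i%C != 0 :> R[i] by rewrite neq0Ci.
pose Q (g : _ -> R[i]) w := 'i%C ^+ r * Pi g w.
have dQ : poly_diffop Q.
  apply: (poly_diffop_comp (P := fun g w => 'i%C ^+ r * g w)).
    exact/(poly_diffop_mul (p := fun=> 'i%C ^+ r))/polyfun_cst.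
  exact: cst_poly_diffop.
rewrite (diffop_eq_polyfun (bilin_pairing V) (@pairing_surj R V) i0
  (cst_poly_diffop cP) dQ _ Pp) //.
by apply/funext => x; apply/funext => y; exact: detop_exp.
Qed.

End DeterminantOperators.

(** * The recurrence in terms of the operators D *)

Section Symbols.
Variables (R : realType) (V : vectType R).
Notation W := (V * V)%type.
Notation W' := ('Hom(V, R^o) * 'Hom(V, R^o))%type.
Notation E := (fun x (xi : W') => cexp ('i%C * (@pairing R V x xi)%:C)).

Lemma poly_diffop_sum (U : vectType R) n (L : 'I_n -> operator R U) :
  (forall i, poly_diffop (L i)) ->
  poly_diffop (fun g w => \sum_(i < n) L i g w).
Proof.
move=> dL; elim: n L dL => [|n IH] L dL.
  rewrite (_ : (fun _ => _) = fun g w => 0 * g w).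
    exact/(poly_diffop_mul (p := fun=> 0))/polyfun_cst.
  by apply/funext => g; apply/funext => w; rewrite big_ord0 mul0r.
rewrite (_ : (fun _ => _) =
    fun g w => L ord0 g w + \sum_(i < n) L (lift ord0 i) g w).
  by apply: poly_diffop_add => //; apply: IH.
by apply/funext => g; apply/funext => w; rewrite big_ord_recl.
Qed.

Lemma poly_diffop_family_diffop (U : vectType R) D s t :
  @poly_diffop_family R U D -> poly_diffop (D s t).
Proof.
move=> [N [L [dL DE]]].
rewrite (_ : D s t = fun g w => \sum_(a < N) \sum_(b < N) s ^+ a * t ^+ b * L a b g w).
  apply: poly_diffop_sum => a; apply: poly_diffop_sum => b.
  apply: (poly_diffop_comp (P := fun g w => s ^+ a * t ^+ b * g w)) => //.
  exact/(poly_diffop_mul (p := fun=> s ^+ a * t ^+ b))/polyfun_cst.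
by apply/funext => g; apply/funext => w; exact: DE.
Qed.

Lemma poly_diffop_family_bipoly (U : vectType R) D g w :
  @poly_diffop_family R U D -> bipoly (fun s t => D s t g w).
Proof.
move=> [N [L [dL DE]]].
have [q qE] : bipoly (fun s t => \sum_(a < N) \sum_(b < N) s ^+ a * t ^+ b * L a b g w).
  apply: bipoly_sum => a; apply: bipoly_sum => b.
  apply: bipolyM; last exact: bipoly_cst.
  by apply: bipolyM; apply: bipolyX; [exact: bipoly_fst|exact: bipoly_snd].
by exists q => s t; rewrite DE qE.
Qed.

Variable F : R[i] -> R[i] -> operator R W.
Hypothesis hF : forall la mu, poly_diffop (F la mu).

Lemma FiterSr k la mu g :
  Fiter F k.+1 la mu g = Fiter F k (la + 1) (mu + 1) (F la mu g).
Proof.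
elim: k => [|k IH]; first by rewrite /= !addr0.
rewrite -[LHS]/(F (la + k.+1%:R) (mu + k.+1%:R) (Fiter F k.+1 la mu g)) IH /=.
by rewrite -natr1 [k%:R + 1]addrC !addrA.
Qed.

Lemma poly_diffop_Fiter k la mu : poly_diffop (Fiter F k la mu).
Proof.
elim: k => [|k IH]; last exact: (poly_diffop_comp (hF _ _) IH).
rewrite (_ : Fiter F 0 la mu = fun g w => 1 * g w).
  exact/(poly_diffop_mul (p := fun=> 1))/polyfun_cst.
by apply/funext => g; apply/funext => w; rewrite mul1r.
Qed.

Variable b : nat -> R[i] -> R[i] -> W' -> R[i].
Hypothesis hb : forall k la mu, is_bisymbol (Bop F k la mu) (b k la mu).

(** Since E = 1 at x = 0, the symbol is the value of the operator there. *)
Lemma bisymbol_at0 k la mu : b k la mu = lft (Fiter F k la mu) E 0.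
Proof.
apply/funext => xi; rewrite [RHS](hb k la mu xi 0) /cexpp /pairing /=.
by rewrite !linear0 addr0 mulr0 cexp0 mulr1.
Qed.

Lemma polyfun_bisymbol k la mu : polyfun (b k la mu).
Proof.
rewrite bisymbol_at0; have Bb := bilin_pairing V.
apply: (@exppoly_polyfun_r _ _ _ 'i%C (@pairing R V)) => [y|].
  by rewrite /pairing /= !linear0 addr0.
exact: (exppoly_lft Bb (poly_diffop_Fiter _ _ _) (exppoly_e _ _)).
Qed.

Lemma bisymbol_recurrence k la mu (M : operator R W') : poly_diffop M ->
  lft (F la mu) E = rgt M E ->
  b k.+1 la mu = M (b k (la + 1) (mu + 1)).
Proof.
move=> dM FM; rewrite !bisymbol_at0.
have -> : lft (Fiter F k.+1 la mu) E =
    lft (Fiter F k (la + 1) (mu + 1)) (lft (F la mu) E).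
  by apply/funext => x; apply/funext => y; rewrite /lft FiterSr.
have EE := exppoly_e 'i%C (@pairing R V).
by rewrite FM (lft_rgt (bilin_pairing V) (poly_diffop_Fiter _ _ _) dM EE).
Qed.

End Symbols.

(** * The recurrence relation *)

Lemma polyfun_ddet (R : realType) (V : vectType R) (mul : V -> V -> V) (e : V)
    (r : nat) (m : V -> {poly R}) : generic_minpoly mul e r m ->
  polyfun (fun xi => (ddet mul r m xi)%:C).
Proof. move=> /polyfun_jdet; exact: polyfun_comp. Qed.

Theorem proposition3p4
  (R : realType) (V : vectType R) (mul : V -> V -> V) (e : V)
  (hV : simple_jordan mul e)
  (n : nat) (hn : n = \dim {: V})
  (r : nat) (m : V -> {poly R}) (hm : generic_minpoly mul e r m)
  (* det(d/dxi - d/dzeta) and det((1/i)(d/dxi - d/dzeta)) *)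
  (P Pi : operator R ('Hom(V, R^o) * 'Hom(V, R^o)))
  (hP : is_detop r m 1 P)
  (hPi : is_detop r m 'i%C Pi)
  (D : R[i] -> R[i] -> operator R ('Hom(V, R^o) * 'Hom(V, R^o)))
  (hD : poly_diffop_family D)
  (hDi : forall eps eta : bool,
     generic (fun s t => intertwines mul r m eps eta s t Pi (D s t)))
  (d : R[i] -> R[i] -> 'Hom(V, R^o) * 'Hom(V, R^o) -> V * V -> R[i])
  (hd : forall s t, is_dual_symbol (D s t) (d s t))
  (F : R[i] -> R[i] -> operator R (V * V))
  (hF : forall la mu, poly_diffop (F la mu))
  (f : R[i] -> R[i] -> V * V -> 'Hom(V, R^o) * 'Hom(V, R^o) -> R[i])
  (hf : forall la mu, is_symbol (F la mu) (f la mu))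
  (hfd : forall la mu x xi,
     f la mu x xi =
     d (la - n%:R / r%:R + 1) (mu - n%:R / r%:R + 1) xi x)
  (b : nat -> R[i] -> R[i] -> 'Hom(V, R^o) * 'Hom(V, R^o) -> R[i])
  (hb : forall k la mu, is_bisymbol (Bop F k la mu) (b k la mu))
  (k : nat) (hk : (1 <= k)%N) (la mu : R[i]) (eps eta : bool)
  (xi zeta : 'Hom(V, R^o))
  (hxi : ddet mul r m xi != 0) (hzeta : ddet mul r m zeta != 0) :
  spow (~~ eps) (la - n%:R / r%:R) (ddet mul r m xi) *
  spow (~~ eta) (mu - n%:R / r%:R) (ddet mul r m zeta) *
  b k la mu (xi, zeta) =
  (* the constant i^-r comes from the normalization of D by
     det((1/i)(d/dxi - d/dzeta)) = i^-r det(d/dxi - d/dzeta) *)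
  ('i%C : R[i]) ^- r *
  P (fun u => spow eps (la - n%:R / r%:R + 1) (ddet mul r m u.1) *
              spow eta (mu - n%:R / r%:R + 1) (ddet mul r m u.2) *
              b k.-1 (la + 1) (mu + 1) u) (xi, zeta).
Proof.
have homog := jdet_scale (sj_linear hV) (sj_comm hV) hm.
pose d1 (u : 'Hom(V, R^o) * 'Hom(V, R^o)) := ddet mul r m u.1.
pose d2 (u : 'Hom(V, R^o) * 'Hom(V, R^o)) := ddet mul r m u.2.
have Pd1 : polyfun (fun u => (d1 u)%:C).
  have [g gE] := @linear_lfun R _ _ (fun u : 'Hom(V, R^o) * 'Hom(V, R^o) => u.1)
    (fun _ _ _ => erefl).
  rewrite (_ : (fun u => _) = fun u => (ddet mul r m (g u))%:C).
    exact: (polyfun_comp g (polyfun_ddet hm)).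
  by apply/funext => u; rewrite -gE.
have Pd2 : polyfun (fun u => (d2 u)%:C).
  have [g gE] := @linear_lfun R _ _ (fun u : 'Hom(V, R^o) * 'Hom(V, R^o) => u.2)
    (fun _ _ _ => erefl).
  rewrite (_ : (fun u => _) = fun u => (ddet mul r m (g u))%:C).
    exact: (polyfun_comp g (polyfun_ddet hm)).
  by apply/funext => u; rewrite -gE.
case: k hk => // k _ /=; set phi := b k (la + 1) (mu + 1).
have Pphi : polyfun phi by exact: polyfun_bisymbol.
set s0 := la - _ + 1; set t0 := mu - _ + 1; set w := (xi, zeta).
have -> : la - n%:R / r%:R = s0 - 1 by rewrite addrK.
have -> : mu - n%:R / r%:R = t0 - 1 by rewrite addrK.
rewrite !spow_subr1 //.
have -> : b k.+1 la mu = D s0 t0 phi.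
  apply: (bisymbol_recurrence hF hb); first exact: poly_diffop_family_diffop.
  apply/funext => x; apply/funext => y.
  exact: etrans (hf la mu x y) (etrans (congr1 (fun z => z * _) (hfd _ _ _ _))
    (esym (hd s0 t0 x y))).
have rw : nonvanishing d1 d2 w by [].
have [G rG PG] := cst_diffop_powers Pd1 Pd2 eps eta hP.1 (ratfam_poly d1 d2 Pphi).
rewrite [P _ w](PG s0 t0 w rw).
pose I := (d1 w)%:C^-1 * (d2 w)%:C^-1.
(* after division by det xi^s det zeta^t both sides are polynomial in (s, t) *)
suff key : 'i%C ^- r * G s0 t0 w = I * D s0 t0 phi w.
  by rewrite [RHS]mulrCA key /powers /I /d1 /d2 /=; ring.
have [q [q0 hq]] := hDi eps eta.
(* naturals of the parity prescribed by the sign *)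
pose expo (sg : bool) (j : nat) : R[i] := (j.*2 + sg)%:R.
have expo_inj sg : injective (expo sg).
  by move=> j l /eqP; rewrite eqr_nat eqn_add2r => /eqP/double_inj.
have spowE sg j y : y != 0 -> spow sg (expo sg j) y = y%:C ^+ (j.*2 + sg).
  by move=> y0; rewrite -spow_nat // oddD odd_double oddb.
move: s0 t0 => s t.
apply: (bipoly_grid (expo_inj eps) (expo_inj eta) q0 _ _ _ s t
  (h := fun s t => 'i%C ^- r * G s t w) (k := fun s t => I * D s t phi w)).
- by apply: bipolyM; [exact: bipoly_cst|exact: ratfam_bipoly rG].
- by apply: bipolyM; [exact: bipoly_cst|exact: poly_diffop_family_bipoly].
move=> j l /hq/(_ phi (polyfun_smooth Pphi) xi zeta hxi hzeta).
set s1 := expo eps j; set t1 := expo eta l.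
(* the function that powers * phi equals where the determinants do not vanish *)
pose mono u := (d1 u)%:C ^+ (j.*2 + eps) * (d2 u)%:C ^+ (l.*2 + eta) * phi u.
have Pmono : polyfun mono.
  by apply: polyfun_mul => //; apply: polyfun_mul; exact: polyfun_exp.
have monoE L : cst_diffop L ->
    L (fun u => powers d1 d2 eps eta s1 t1 u * phi u) w = L mono w.
  move=> cL; apply: (cst_diffop_local (U := nonvanishing d1 d2)) => //.
    by move=> u v; exact: nonvanishing_near.
  by move=> u [u1 u2]; rewrite /powers !spowE.
have pw0 : powers d1 d2 eps eta s1 t1 w != 0.
  by rewrite /powers !spowE // mulf_neq0 // expf_neq0 // fmorph_eq0.
have ir0 : 'i%C ^+ r != 0 :> R[i] by rewrite expf_neq0 // neq0Ci.
rewrite !spow_subr1 // => inter.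
apply: (mulfI pw0); apply: (mulfI ir0).
rewrite [powers _ _ _ _ _ _ _ * ('i%C ^- r * _)]mulrCA mulVKf //.
rewrite -(PG s1 t1 w rw).
rewrite (monoE _ hP.1) (detop_polyfun homog hP hPi _ Pmono) -(monoE _ hPi.1).
rewrite [Pi _ w]inter /powers /I /d1 /d2 /=; ring.
Qed.
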